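(* Let $C\subset\mathbb{C}^2$ be an irreducible complex algebraic plane curve of degree greater than one. The following are equivalent (in (2) and (3), $n$ denotes the same positive integer: for each $n$, (2) holds with that $n$ if and only if (3) holds with that $n$, and each of (1), (4) is equivalent to (2), respectively (3), holding for some $n$): (1) The image $d_3(C^3)$ is Zariski-dense in $\mathbb{C}^3$. (2) The symmetry group satisfies $|\mathrm{Sym}(C,\mathcal{E}_2(\mathbb{C}))|=n<\infty$. (3) The map $d_4:C^4\to\mathbb{C}^6$ is generically $n:1$. (4) $\dim(\mathcal{J}_C)=4$.
   Context: The Euclidean group $\mathcal{E}_2(\mathbb{C})$ is the group of matrices $\begin{bmatrix}\alpha c&\alpha s&a\\-s&c&b\\0&0&1\end{bmatrix}$ with $a,b,c,s\in\mathbb{C}$, $\alpha\in\{-1,1\}$, $c^2+s^2=1$, acting on $\mathbb{C}^2$ by $g\cdot(x,y)=(\alpha(cx+sy)+a,\,-sx+cy+b)$. The symmetry group is $\mathrm{Sym}(C,\mathcal{E}_2(\mathbb{C}))=\{g\in\mathcal{E}_2(\mathbb{C}) : C=\overline{g\cdot C}\}$ (Zariski closure). For points $p_j=(x_j,y_j)\in\mathbb{C}^2$ put $d_{jk}=(x_j-x_k)^2+(y_j-y_k)^2$. For $n\ge 2$, $d_n:C^n\to\mathbb{C}^{n(n-1)/2}$ sends $(p_1,\dots,p_n)$ to the tuple of all $d_{jk}$, $1\le j<k\le n$. The Euclidean joint signature is $\mathcal{J}_C=d_4(C^4)\subset\mathbb{C}^6$; its dimension is that of its Zariski closure. ''$d_4$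 is generically $n:1$'' means that for all $p$ in some nonempty Zariski-open subset of $C^4$, the fiber $d_4^{-1}(d_4(p))\subset C^4$ has exactly $n$ points. *)

(* Defs.v *)
From HB Require Import structures.
From mathcomp Require Import all_boot all_order all_algebra.
From mathcomp Require Import complex boolp classical_sets functions cardinality.
From mathcomp Require Import reals.
From mathcomp Require Import mpoly ring.

Set Implicit Arguments.
Unset Strict Implicit.
Unset Printing Implicit Defensive.

Import GRing.Theory.
Local Open Scope classical_set_scope.
Local Open Scope ring_scope.

Section Zariski.
Variables (K : fieldType) (m : nat).
Implicit Types (A X : set 'rV[K]_m) (S : set {mpoly K[m]}).

Definition zeros S : set 'rV[K]_m :=
  [set v | forall f, S f -> f.@[fun i => v 0 i] = 0].

Definition zclosed A := exists S, A = zeros S.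

Definition zclosure A : set 'rV[K]_m := smallest zclosed A.

Definition zdense A := zclosure A = [set: 'rV[K]_m].

Definition zirreducible A :=
  A !=set0 /\ forall U V, zclosed U -> zclosed V ->
    A `<=` U `|` V -> A `<=` U \/ A `<=` V.

(* Only the values Z 0, ..., Z d matter. *)
Definition zchain X (d : nat) (Z : nat -> set 'rV[K]_m) :=
  (forall i, (i <= d)%N -> [/\ zclosed (Z i), zirreducible (Z i) & Z i `<=` X])
  /\ (forall i, (i < d)%N -> Z i `<` Z i.+1).

(* Krull dimension of the Zariski closure. *)
Definition zdim_is X (d : nat) :=
  (exists Z, zchain (zclosure X) d Z) /\
  (forall e Z, zchain (zclosure X) e Z -> (e <= d)%N).

End Zariski.

Definition mirreducible (K : fieldType) (m : nat) (F : {mpoly K[m]}) :=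
  [/\ F != 0, F \isn't a GRing.unit &
      forall G H, F = G * H -> G \is a GRing.unit \/ H \is a GRing.unit].

(* [msize F] is the total degree of F plus one. *)
Definition irreducible_plane_curve (K : fieldType) (C : set 'rV[K]_2)
    (d : nat) :=
  exists F : {mpoly K[2]},
    [/\ mirreducible F, msize F = d.+1 & C = zeros [set F]].

Section Euclidean.
Variable K : fieldType.

Definition euclid_mx (alpha c s a b : K) : 'M[K]_3 :=
  \matrix_(i, j)
    nth 0 (nth [::] [:: [:: alpha * c; alpha * s; a];
                        [:: - s;       c;         b];
                        [:: 0;         0;         1]] i) j.

Definition euclid : set 'M[K]_3 :=
  [set g | exists alpha c s a b : K,
     [/\ alpha = -1 \/ alpha = 1, c ^+ 2 + s ^+ 2 = 1
       & g = euclid_mx alpha c s a b]].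

(* Transpose of g *m (x, y, 1)^T, with the last coordinate dropped. *)
Definition act (g : 'M[K]_3) (v : 'rV[K]_2) : 'rV[K]_2 :=
  lsubmx (row_mx v (1 : 'M[K]_1) *m g^T : 'rV[K]_(2 + 1)).

Lemma act_euclid (alpha c s a b : K) (v : 'rV[K]_2) :
  let x := v 0 0 in let y := v 0 1 in
  act (euclid_mx alpha c s a b) v 0 0 = alpha * (c * x + s * y) + a /\
  act (euclid_mx alpha c s a b) v 0 1 = - s * x + c * y + b.
Proof.
have rl k : (row_mx v (1 : 'M[K]_1) : 'rV[K]_(2 + 1)) 0 (lshift 1 k) = v 0 k.
  exact: row_mxEl.
have r0 : (row_mx v (1 : 'M[K]_1) : 'rV[K]_(2 + 1)) 0 ord0 = v 0 0.
  by rewrite -rl; congr (row_mx _ _ _ _); apply: val_inj.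
have r1 : (row_mx v (1 : 'M[K]_1) : 'rV[K]_(2 + 1)) 0 (lift ord0 ord0) = v 0 1.
  by rewrite -rl; congr (row_mx _ _ _ _); apply: val_inj.
have r2 : (row_mx v (1 : 'M[K]_1) : 'rV[K]_(2 + 1)) 0
    (lift ord0 (lift ord0 ord0)) = 1.
  transitivity ((row_mx v (1 : 'M[K]_1) : 'rV[K]_(2 + 1)) 0 (rshift 2 0)).
    by congr (row_mx _ _ _ _); apply: val_inj.
  by rewrite row_mxEr mxE.
rewrite /act /= !mxE !big_ord_recl !big_ord0 r0 r1 r2 !mxE /=.
by split; ring.
Qed.

Definition Sym (C : set 'rV[K]_2) : set 'M[K]_3 :=
  [set g | euclid g /\ C = zclosure (act g @` C)].

Definition sqdist (p q : 'rV[K]_2) : K :=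
  (p 0 0 - q 0 0) ^+ 2 + (p 0 1 - q 0 1) ^+ 2.

(* C^n, as the set of n x 2 matrices whose rows lie in C; [mxvec] embeds it
   in the affine space of dimension n * 2. *)
Definition cpow (C : set 'rV[K]_2) (n : nat) : set 'M[K]_(n, 2) :=
  [set P | forall j, C (row j P)].
Arguments cpow : clear implicits.

Definition pairs (n : nat) : {pred 'I_n * 'I_n} :=
  [pred jk : 'I_n * 'I_n | (jk.1 < jk.2)%N].
Arguments pairs : clear implicits.

Lemma card_pairs (n : nat) : #|pairs n| = 'C(n, 2).
Proof.
rewrite -sum1_card /pairs /= -(pair_big_dep xpredT
  (fun j k : 'I_n => (j < k)%N) (fun _ _ => 1%N)) /=.
rewrite (exchange_big_dep xpredT) //= -bin2_sum big_mkord; apply: eq_bigr => k _.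
by rewrite -(big_ord_widen n (fun _ => 1%N) (ltnW (ltn_ord k))) sum1_card card_ord.
Qed.

(* The coordinates of d_n P are the d_jk for j < k, each occurring once, in
   the order in which [pairs n] is enumerated. *)
Definition dmap (n : nat) (P : 'M[K]_(n, 2)) : 'rV[K]_('C(n, 2)) :=
  \row_e let jk := enum_val (cast_ord (esym (card_pairs n)) e) in
         sqdist (row jk.1 P) (row jk.2 P).

Definition joint_signature (C : set 'rV[K]_2) : set 'rV[K]_6 :=
  @dmap 4 @` cpow C 4.

Definition dmap_generically (m : nat) (C : set 'rV[K]_2) (n : nat) :=
  exists Z : set 'rV[K]_(m * 2),
    [/\ zclosed Z,
        cpow C m `&` [set P | ~ Z (mxvec P)] !=set0 &
        forall P, (cpow C m `&` [set P | ~ Z (mxvec P)]) P ->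
          ([set Q | cpow C m Q /\ dmap Q = dmap P] #= `I_n)%card].

End Euclidean.

Arguments cpow {K} C n.

(* Main.v *)
Require Import Defs.
From HB Require Import structures.
From mathcomp Require Import all_boot all_order all_algebra.
From mathcomp Require Import complex boolp classical_sets functions cardinality.
From mathcomp Require Import reals.
From mathcomp Require Import mpoly ring zify.

Set Implicit Arguments.
Unset Strict Implicit.
Unset Printing Implicit Defensive.

Import GRing.Theory Num.Theory.
Local Open Scope classical_set_scope.
Local Open Scope ring_scope.

(* A plane curve C = {F = 0} is handled through three elementary facts: F is prime in
   K[x, y], a polynomial not vanishing on C has finitely many zeros on it, and (by
   counting monomials modulo F) any k + 1 polynomial functions on C^k are dependent.

   If Sym C is infinite, some a in C has an infinite, hence dense, orbit. Distances being
   invariant, d_n(C^(n-1) x {a}) is dense in d_n(C^n), so n polynomial functions on it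
   are always dependent: d_3 is not dominant, dim J_C < 4 and the fibres of d_4 are
   infinite.

   If Sym C is finite but Q(d_12, d_13, d_23) = 0 on C^3, choose segments [p_i, q_i] in C
   of one common length, the p_i lying in distinct Sym C-orbits. The motions g_i taking
   [p_0, q_0] to [p_i, q_i] give pairwise distinct curves g_i^-1 C, all contained in the
   curve {r : Q(|p_0 q_0|^2, |p_0 r|^2, |q_0 r|^2) = 0}; its degree bounds their number.

   If d_3 is dominant, take a relation Phi(d_12, d_13, d_23, d_14, d_24) = 0 on C^4. For
   P = (p_1, ..., p_4) in C^4 and gP in C^4, both C and g^-1 C are components of the curve
   cut out by Phi when p_4 varies. If g is not a symmetry this curve is more singular
   at p_4 than at a generic point of C, which is a closed condition on P. So the generic
   fibre of d_4 is a Sym C-orbit.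

   Chains of closed sets are compared with transcendence degree by lowest terms of
   algebraic relations. *)

(** * Irreducible polynomials in two variables *)

(** Degrees and dimensions enter through counting alone. Modulo F there are O(N) monomials of degree
    at most N, so functions of degree O(N) on C^k span a space of dimension O(N^k), while k + 1
    functions have (N + 1)^(k + 1) power products with exponents at most N.

    For finite Sym C, an equality g_i^-1 C = g_j^-1 C would make g_j g_i^-1 a symmetry taking p_i to
    p_j: hence the distinct orbits. A common length exists because the squared distances from a
    point of C to C miss only finitely many values.

    For the generic fibres, the obstacle is that the locus cut out by Phi may contain C several
    times. Orders of vanishing along lines through p_4 are therefore compared with their minimum m
    over C^4: a locus containing C to the power j has m <= e j, where e is the generic order of F,
    and a second component g^-1 C contributes as much again. The distance d_34 is left out of Phi
    because, p_1 and p_2 being given, d_14 and d_24 can be prescribed freely for a point of the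
    plane; this keeps Phi nontrivial as an equation in p_4. *)

Section PolyPoly.
Variable K : closedFieldType.
Implicit Types (a : K) (c : {poly K}) (A B P G : {poly {poly K}}).

Lemma poly_size1_or_root c : c != 0 -> (size c == 1%N) \/ exists a, root c a.
Proof.
move=> c0; case: eqVneq => sc; [by left | right].
exact/closed_rootP.
Qed.

Lemma dvd_XsubC_coef a P : map_poly (horner_eval a) P = 0 ->
  exists Q, P = ('X - a%:P)%:P * Q.
Proof.
move=> P0; exists (map_poly (fun c => c %/ ('X - a%:P)) P).
apply/polyP => i; rewrite coefCM coef_map_id0 ?div0p // mulrC divpK //.
rewrite dvdp_XsubCl; have := congr1 (fun Q : {poly K} => Q`_i) P0.
by rewrite coef_map coef0 => /eqP.
Qed.

Lemma horner_eval_XsubC_mul a P :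
  map_poly (horner_eval a) (('X - a%:P)%:P * P) = 0.
Proof. by rewrite rmorphM /= map_polyC /= /horner_eval hornerXsubC subrr mul0r. Qed.

(** Gauss's lemma over K[x], removing one linear factor of [c] at a time: x - a is prime because
    setting x = a maps into an integral domain, so it divides [A] or [B]. Keeping the degrees in the
    outer variable later allows trivial factors to be recognized. *)
Lemma const_dvd_mul c P A B : c != 0 -> c%:P * P = A * B ->
  exists A' B', [/\ P = A' * B', size A' = size A & size B' = size B].
Proof.
move: {2}(size c) (leqnn (size c)) => n.
elim: n c A B => [|n IHn] c A B; first by rewrite leqn0 size_poly_eq0 => ->.
move=> cn c0 e; have [/eqP c1|[a /factor_theorem [q cE]]] := poly_size1_or_root c0.
  have [k k0 kE] : exists2 k, k != 0 & c = k%:P.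
    by exists c`_0; [move: c0; rewrite {1}(size1_polyC (eq_leq c1)) polyC_eq0
                    | apply: size1_polyC; rewrite c1].
  exists ((k^-1)%:P%:P * A), B; split=> //.
    by rewrite -mulrA -e kE mulrA -!polyCM mulVf // mul1r.
  by rewrite size_Cmul // polyC_eq0 invr_eq0.
have q0 : q != 0 by apply: contra_neq c0 => q0; rewrite cE q0 mul0r.
have Xa0 : 'X - a%:P != 0 :> {poly K} by rewrite polyXsubC_eq0.
have qn : (size q <= n)%N.
  by move: cn; rewrite cE size_mul // size_XsubC addn2.
have XaP0 : ('X - a%:P)%:P != 0 :> {poly {poly K}} by rewrite polyC_eq0.
have e2 : ('X - a%:P)%:P * (q%:P * P) = A * B by rewrite -e cE polyCM; ring.
have := horner_eval_XsubC_mul a (q%:P * P).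
rewrite e2 rmorphM /= => /eqP; rewrite mulf_eq0 => /orP[] /eqP /dvd_XsubC_coef [D DE].
  have [|A' [B' [-> sA sB]]] := IHn q D B qn q0.
    by apply: (mulfI XaP0); rewrite e2 DE mulrA.
  by exists A', B'; rewrite DE size_Cmul.
have [|A' [B' [-> sA sB]]] := IHn q A D qn q0.
  by apply: (mulfI XaP0); rewrite e2 DE mulrCA.
by exists A', B'; rewrite DE size_Cmul.
Qed.

Variable P : {poly {poly K}}.
Hypothesis P_irr : forall A B, P = A * B -> A \is a GRing.unit \/ B \is a GRing.unit.
Hypothesis P_size : (1 < size P)%N.

Lemma P_neq0 : P != 0.
Proof. by rewrite -size_poly_gt0 (ltn_trans _ P_size) //. Qed.

Lemma irr_eval_neq0 a : map_poly (horner_eval a) P != 0.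
Proof.
apply/eqP => /dvd_XsubC_coef [Q PE].
have Xa0 : 'X - a%:P != 0 :> {poly K} by rewrite polyXsubC_eq0.
case: (P_irr PE); rewrite poly_unitE => /andP[/eqP sQ].
  by rewrite coefC /= poly_unitE size_XsubC.
by move: P_size; rewrite PE size_Cmul // sQ.
Qed.

(** The roots of [c] are removed one by one: [P] is not identically zero at x = a, so x - a must
    divide [B]. *)
Lemma irr_dvd_const c G B : c != 0 -> c%:P * G = P * B -> exists D, G = P * D.
Proof.
move: {2}(size c) (leqnn (size c)) => n.
elim: n c B => [|n IHn] c B; first by rewrite leqn0 size_poly_eq0 => ->.
move=> cn c0 e; have [/eqP c1|[a /factor_theorem [q cE]]] := poly_size1_or_root c0.
  have [k k0 kE] : exists2 k, k != 0 & c = k%:P.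
    by exists c`_0; [move: c0; rewrite {1}(size1_polyC (eq_leq c1)) polyC_eq0
                    | apply: size1_polyC; rewrite c1].
  exists ((k^-1)%:P%:P * B).
  by rewrite mulrCA -e kE mulrA -!polyCM mulVf // mul1r.
have q0 : q != 0 by apply: contra_neq c0 => q0; rewrite cE q0 mul0r.
have Xa0 : 'X - a%:P != 0 :> {poly K} by rewrite polyXsubC_eq0.
have qn : (size q <= n)%N.
  by move: cn; rewrite cE size_mul // size_XsubC addn2.
have XaP0 : ('X - a%:P)%:P != 0 :> {poly {poly K}} by rewrite polyC_eq0.
have e2 : ('X - a%:P)%:P * (q%:P * G) = P * B by rewrite -e cE polyCM; ring.
have := horner_eval_XsubC_mul a (q%:P * G).
rewrite e2 rmorphM /= => /eqP; rewrite mulf_eq0 (negPf (irr_eval_neq0 a)) /=.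
move=> /eqP /dvd_XsubC_coef [D DE].
apply: (IHn q D qn q0); apply: (mulfI XaP0).
by rewrite e2 DE mulrCA.
Qed.

(* The resultant in the second variable, or [G] itself when it is constant. *)
Lemma irr_elimination G : ~ (exists D, G = P * D) ->
  exists U V c, c != 0 /\ U * P + V * G = c%:P.
Proof.
move=> PG; have G0 : G != 0 by apply/eqP => G0; apply: PG; exists 0; rewrite mulr0.
have [sG|sG] := leqP (size G) 1.
  exists 0, 1, G`_0; rewrite mul0r add0r mul1r -size1_polyC //; split=> //.
  by apply: contra_neq G0 => G0; rewrite (size1_polyC sG) G0.
have [[U V] /= [_ _ e]] := resultant_in_ideal P_size sG.
exists U, V, (resultant P G); split; last by rewrite e.
rewrite resultant_eq0 -leqNgt; set D := gcdp P G.
have D0 : D != 0 by rewrite gcdp_eq0 negb_and P_neq0.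
(* A gcd [D] of positive degree gives c1 P = E1 D. By Gauss's lemma and irreducibility [E1] has
   degree 0, so [P] divides [G] up to a nonzero factor in K[x], which cancels. *)
rewrite leqNgt; apply/negP => sD; apply: PG.
have /Pdiv.Idomain.dvdpP[[c1 E1] /= c10 e1] := dvdp_gcdl P G.
have /Pdiv.Idomain.dvdpP[[c2 E2] /= c20 e2] := dvdp_gcdr P G.
rewrite -/D in e1 e2; rewrite -mul_polyC in e1; rewrite -mul_polyC in e2.
have [A [B [PE sA sB]]] := const_dvd_mul c10 e1.
have sE1 : size E1 = 1%N.
  case: (P_irr PE); rewrite poly_unitE => /andP[/eqP sz _]; first by rewrite -sA.
  by move: sD; rewrite -sB sz.
have E10 : E1`_0 != 0.
  have : E1 != 0 by rewrite -size_poly_gt0 sE1.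
  by apply: contra_neq => E0; rewrite (size1_polyC (eq_leq sE1)) E0.
apply: (@irr_dvd_const (E1`_0 * c2) G (c1%:P * E2)); first by rewrite mulf_neq0.
rewrite polyCM -(size1_polyC (eq_leq sE1)) -mulrA e2.
transitivity (E2 * (c1%:P * P)); [rewrite e1|]; ring.
Qed.

(** From U P + V G = c follows c B = P (U B + V D), and the factor [c] in K[x] cancels. *)
Lemma irr_prime G B : (exists D, G * B = P * D) ->
  (exists D, G = P * D) \/ (exists D, B = P * D).
Proof.
move=> [D e]; have [|/irr_elimination [U [V [c [c0 e2]]]]] := pselect (exists D, G = P * D).
  by left.
right; apply: (@irr_dvd_const c B (U * B + V * D)) => //.
by rewrite -e2 mulrDl -[V * G * B]mulrA e; ring.
Qed.

End PolyPoly.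

Lemma mpoly_rmorph_eq n (R S : comNzRingType) (f g : {rmorphism {mpoly R[n]} -> S}) :
  (forall c, f c%:MP = g c%:MP) -> (forall i, f 'X_i = g 'X_i) -> f =1 g.
Proof.
move=> fgC fgX p; rewrite [p]mpolyE !rmorph_sum; apply: eq_bigr => m _.
rewrite -mul_mpolyC !rmorphM fgC; congr (_ * _).
rewrite mpolyXE_id !rmorph_prod; apply: eq_bigr => i _.
by rewrite !rmorphXn fgX.
Qed.

Lemma mpoly_unitE n (R : idomainType) (p : {mpoly R[n]}) : p \is a GRing.unit ->
  p = (p@_0%MM)%:MP.
Proof. by case/andP => /eqP. Qed.

Lemma msize_unit n (R : idomainType) (p : {mpoly R[n]}) : p \is a GRing.unit ->
  msize p = 1%N.
Proof.
move=> up; move: (up); rewrite [in X in X -> _](mpoly_unitE up) => uc.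
rewrite (mpoly_unitE up) msizeC; case: eqP uc => // ->.
by rewrite unitr0.
Qed.

(** * The isomorphism of K[x, y] with K[x][y], and finite intersections *)

Section Bivariate.
Variable K : closedFieldType.
Implicit Types (F G H : {mpoly K[2]}) (v : 'rV[K]_2).

(** The abscissa becomes the inner variable and the ordinate the outer one, so elimination removes
    the ordinate. *)
Definition to_polypoly : {mpoly K[2]} -> {poly {poly K}} :=
  mmap (polyC \o polyC) (fun i : 'I_2 => if i == 0 then ('X)%:P else 'X).

HB.instance Definition _ := GRing.RMorphism.on to_polypoly.

Definition of_poly : {poly K} -> {mpoly K[2]} :=
  horner_eval 'X_0 \o map_poly (@mpolyC 2 K).

HB.instance Definition _ := GRing.RMorphism.on of_poly.

Definition of_polypoly : {poly {poly K}} -> {mpoly K[2]} :=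
  horner_eval 'X_1 \o map_poly of_poly.

HB.instance Definition _ := GRing.RMorphism.on of_polypoly.

Lemma to_polypolyC c : to_polypoly c%:MP = c%:P%:P.
Proof. by rewrite /to_polypoly mmapC. Qed.

Lemma to_polypolyX0 : to_polypoly 'X_0 = ('X)%:P.
Proof. by rewrite /to_polypoly mmapX mmap1U. Qed.

Lemma to_polypolyX1 : to_polypoly 'X_1 = 'X.
Proof. by rewrite /to_polypoly mmapX mmap1U. Qed.

Lemma of_polyC c : of_poly c%:P = c%:MP.
Proof. by rewrite /of_poly /= map_polyC /horner_eval hornerC. Qed.

Lemma of_polyX : of_poly 'X = 'X_0.
Proof. by rewrite /of_poly /= map_polyX /horner_eval hornerX. Qed.

Lemma of_polypolyC p : of_polypoly p%:P = of_poly p.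
Proof. by rewrite /of_polypoly /= map_polyC /horner_eval hornerC. Qed.

Lemma of_polypolyX : of_polypoly 'X = 'X_1.
Proof. by rewrite /of_polypoly /= map_polyX /horner_eval hornerX. Qed.

Lemma ord2P (i : 'I_2) : i = 0 \/ i = 1.
Proof. by case: i => [[|[|//]]] lti; [left|right]; apply: val_inj. Qed.

Lemma to_polypolyK : cancel to_polypoly of_polypoly.
Proof.
apply: (@mpoly_rmorph_eq _ _ _ (of_polypoly \o to_polypoly) idfun) => [c|i] /=.
  by rewrite to_polypolyC of_polypolyC of_polyC.
case: (ord2P i) => -> /=; first by rewrite to_polypolyX0 of_polypolyC of_polyX.
by rewrite to_polypolyX1 of_polypolyX.
Qed.

Lemma of_polypolyK : cancel of_polypoly to_polypoly.
Proof.
elim/poly_ind => [|P c IHP]; first by rewrite !rmorph0.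
rewrite !(rmorphD, rmorphM) /= IHP of_polypolyX to_polypolyX1; congr (_ + _).
elim/poly_ind: c => [|p c IHp]; first by rewrite !rmorph0.
rewrite !of_polypolyC in IHp *.
rewrite !(rmorphD, rmorphM) /= IHp of_polyX of_polyC.
by rewrite to_polypolyX0 to_polypolyC.
Qed.

Lemma to_polypoly_horner F v :
  (to_polypoly F).[(v 0 1)%:P].[v 0 0] = F.@[fun i => v 0 i].
Proof.
apply: (@mpoly_rmorph_eq _ _ _
  (horner_eval (v 0 0) \o horner_eval (v 0 1)%:P \o to_polypoly)
  (meval (fun i => v 0 i))) => [c|i] /=.
  by rewrite to_polypolyC /horner_eval !hornerC mevalC.
by case: (ord2P i) => ->; rewrite ?to_polypolyX0 ?to_polypolyX1 /horner_eval
  ?(hornerC, hornerX) mevalXU.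
Qed.

Lemma horner_eval_map (P : {poly {poly K}}) x y :
  (map_poly (horner_eval x) P).[y] = P.[y%:P].[x].
Proof.
have {1}-> : y = horner_eval x y%:P by rewrite /horner_eval hornerC.
by rewrite horner_map.
Qed.

Definition mdvd F G := exists D, G = F * D.

Variable F : {mpoly K[2]}.
Hypothesis F_irr : mirreducible F.
Hypothesis F_deg : (2 < msize F)%N.

Let P := to_polypoly F.

Lemma to_polypoly_irr (A B : {poly {poly K}}) :
  P = A * B -> A \is a GRing.unit \/ B \is a GRing.unit.
Proof.
move=> e; case: F_irr => _ _ /(_ (of_polypoly A) (of_polypoly B)).
case; first by rewrite -rmorphM -e /= to_polypolyK.
  by move=> u; left; rewrite -[A]of_polypolyK rmorph_unit.
by move=> u; right; rewrite -[B]of_polypolyK rmorph_unit.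
Qed.

(** A polynomial in x alone splits into linear factors, so an irreducible one has degree 1; the
    degree assumption on [F] thus forces y to occur. *)
Lemma to_polypoly_size : (1 < size P)%N.
Proof.
rewrite ltnNge; apply/negP => sP; have PE := size1_polyC sP.
have F0 : F != 0 by case: F_irr.
have FE : F = of_poly P`_0 by rewrite -of_polypolyC -PE to_polypolyK.
have c0 : P`_0 != 0 by apply: contra_neq F0; rewrite FE => ->; rewrite rmorph0.
have [/eqP c1|[a /factor_theorem [q qE]]] := poly_size1_or_root c0.
  by move: F_deg; rewrite FE (size1_polyC (eq_leq c1)) of_polyC msizeC; case: (_ != _).
have XE : of_poly ('X - a%:P) = 'X_0 - a%:MP by rewrite rmorphB /= of_polyX of_polyC.
have sX : (msize ('X_0 - a%:MP : {mpoly K[2]})%R <= 2)%N.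
  apply: (leq_trans (msizeD_le _ _)); rewrite msizeN msizeC msizeX mdeg1.
  by rewrite geq_max; case: (_ != _).
have e : F = of_poly q * ('X_0 - a%:MP) by rewrite FE qE rmorphM /= XE.
have q0 : of_poly q != 0 by apply: contra_neq F0; rewrite e => ->; rewrite mul0r.
have X0 : 'X_0 - a%:MP != 0 :> {mpoly K[2]}.
  by apply: contra_neq F0; rewrite e => ->; rewrite mulr0.
case: F_irr => _ _ /(_ _ _ e) [/msize_unit s1|s1].
  by move: F_deg; rewrite e msizeM // s1 add1n /= ltnNge sX.
have kE := mpoly_unitE s1; set k := mcoeff _ _ in kE.
have k0 := congr1 (meval (fun=> a)) kE; have k1 := congr1 (meval (fun=> a + 1)) kE.
move: k0 k1; rewrite !mevalB !mevalXU !mevalC subrr addrAC subrr add0r => <-.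
by move=> /eqP; rewrite oner_eq0.
Qed.

Lemma mdvd_to_polypoly G : (exists D, to_polypoly G = P * D) <-> mdvd F G.
Proof.
split=> [[D e]|[D ->]]; last by exists (to_polypoly D); rewrite rmorphM.
by exists (of_polypoly D); rewrite -[G]to_polypolyK e rmorphM /= to_polypolyK.
Qed.

Lemma mdvd_prime G H : mdvd F (G * H) -> mdvd F G \/ mdvd F H.
Proof.
move=> /mdvd_to_polypoly; rewrite rmorphM.
by move=> /(irr_prime to_polypoly_irr to_polypoly_size) [] /mdvd_to_polypoly; tauto.
Qed.

Lemma poly_roots_seq (p : {poly K}) : p != 0 ->
  exists s : seq K, forall x, root p x -> x \in s.
Proof.
move=> p0; have [s ps] := closed_field_poly_normal p; exists s => x.
by rewrite ps rootZ ?lead_coef_eq0 // root_prod_XsubC.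
Qed.

(** A combination U F + V G = c(x) confines the abscissas to the roots of [c]; on each vertical line
    [F] is a nonzero polynomial, which leaves finitely many ordinates. *)
Lemma curve_inter_finite G : ~ mdvd F G ->
  finite_set [set v : 'rV[K]_2 | F.@[fun i => v 0 i] = 0 /\ G.@[fun i => v 0 i] = 0].
Proof.
move=> nFG; have := irr_elimination to_polypoly_irr to_polypoly_size
  (fun h => nFG ((mdvd_to_polypoly G).1 h)).
move=> [U [V [c [c0 e]]]]; have [s sP] := poly_roots_seq c0.
have [r rP] : exists r : K -> seq K, forall x y, P.[y%:P].[x] = 0 -> y \in r x.
  have /choice [r rP] : forall x, exists t : seq K, forall y, P.[y%:P].[x] = 0 -> y \in t.
    move=> x; have [t tP] := poly_roots_seq (irr_eval_neq0 to_polypoly_irr to_polypoly_size x).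
    by exists t => y; rewrite -horner_eval_map => yr; apply/tP/rootP.
  by exists r.
apply: (@sub_finite_set _ _ [set` [seq \row_j (if j == 0 then x else y) | x <- s, y <- r x]]);
  last exact: finite_seq.
move=> v [Fv Gv] /=; apply/allpairsPdep; exists (v 0 0), (v 0 1); split.
- apply/sP/rootP; have := congr1 (fun Q : {poly {poly K}} => Q.[(v 0 1)%:P].[v 0 0]) e.
  rewrite hornerD !hornerM hornerD !hornerM !to_polypoly_horner Fv Gv.
  by rewrite !mulr0 addr0 hornerC.
- by apply: rP; rewrite to_polypoly_horner.
- by apply/rowP => j; rewrite mxE; case: (ord2P j) => ->.
Qed.

(** Away from the roots of the leading coefficient in y, fixing x preserves the positive degree in
    y, so a root exists. *)
Lemma curve_abscissa_cofinite : exists s : seq K, forall x, x \notin s ->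
  exists2 v : 'rV[K]_2, F.@[fun i => v 0 i] = 0 & v 0 0 = x.
Proof.
have P0 := P_neq0 to_polypoly_size.
have lP0 : lead_coef P != 0 by rewrite lead_coef_eq0.
have [s sP] := poly_roots_seq lP0.
exists s => x xs; have lx : (lead_coef P).[x] != 0.
  by apply: contra xs => /eqP xr; apply/sP/rootP.
have [y] : exists y, root (map_poly (horner_eval x) P) y.
  apply/closed_rootP; rewrite size_map_poly_id0 //; apply/eqP => s1.
  by move: to_polypoly_size; rewrite s1.
rewrite /root horner_eval_map => /eqP Py.
exists (\row_j if j == 0 then x else y); last by rewrite mxE.
by rewrite -to_polypoly_horner !mxE.
Qed.

End Bivariate.

(** * Polynomial functions *)

Section LastVariable.
Variables (R : comNzRingType) (n : nat).

Definition split_last : {mpoly R[n.+1]} -> {poly {mpoly R[n]}} :=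
  mmap (polyC \o @mpolyC n R)
    (fun i => if unlift ord_max i is Some j then ('X_j)%:P else 'X).

HB.instance Definition _ := GRing.RMorphism.on split_last.

Lemma split_lastC c : split_last c%:MP = (c%:MP)%:P.
Proof. by rewrite /split_last mmapC. Qed.

Lemma split_lastX i : split_last 'X_i =
  if unlift ord_max i is Some j then ('X_j)%:P else 'X.
Proof. by rewrite /split_last mmapX mmap1U. Qed.

Lemma split_last_inj : injective split_last.
Proof.
pose lift_vars : {mpoly R[n]} -> {mpoly R[n.+1]} :=
  mmap (@mpolyC n.+1 R) (fun j => 'X_(lift ord_max j)).
pose join := horner_eval ('X_ord_max : {mpoly R[n.+1]}) \o map_poly lift_vars.
apply: (@can_inj _ _ _ join).
apply: (@mpoly_rmorph_eq _ _ _ (join \o split_last) idfun) => [c|i] /=.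
  by rewrite split_lastC /join /= map_polyC /horner_eval hornerC /= /lift_vars mmapC.
rewrite split_lastX /join /=; case: unliftP => [j ->|->].
  by rewrite map_polyC /horner_eval hornerC /= /lift_vars mmapX mmap1U.
by rewrite map_polyX /horner_eval hornerX.
Qed.

Lemma split_last_horner (p : {mpoly R[n.+1]}) v :
  (map_poly (meval (fun j => v (lift ord_max j))) (split_last p)).[v ord_max] = p.@[v].
Proof.
apply: (@mpoly_rmorph_eq _ _ _ (horner_eval (v ord_max) \o
  map_poly (meval (fun j => v (lift ord_max j))) \o split_last) (meval v)) => [c|i] /=.
  by rewrite split_lastC map_polyC /horner_eval hornerC /= !mevalC.
rewrite split_lastX mevalXU; case: unliftP => [j ->|->].
  by rewrite map_polyC /horner_eval hornerC /= mevalXU.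
by rewrite map_polyX /horner_eval hornerX.
Qed.
End LastVariable.

Lemma mpoly0_const (R : comNzRingType) (p : {mpoly R[0]}) : p = (p@_0%MM)%:MP.
Proof.
apply/mpolyP => m; rewrite mcoeffC.
have -> : m = 0%MM by apply/mnmP => -[].
by rewrite eqxx mulr1.
Qed.

Section NonRoot.
Variable K : fieldType.

Lemma infinite_nonroot (S : set K) (p : {poly K}) : infinite_set S -> p != 0 ->
  exists2 x, S x & p.[x] != 0.
Proof.
move=> Sinf p0; have [X XS sX] := infinite_set_fset (size p) Sinf.
have : ~~ all (root p) (finmap.enum_fset X).
  apply/negP => aX; have := max_poly_roots p0 aX (finmap.fset_uniq X).
  by rewrite ltnNge sX.
case/allPn => x xX nx; exists x => //; exact: XS.
Qed.

Lemma mpoly_nonroot n (S : set K) (p : {mpoly K[n]}) : infinite_set S -> p != 0 ->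
  exists2 v, forall i, S (v i) & p.@[v] != 0.
Proof.
move=> Sinf; elim: n p => [|n IHn] p p0.
  exists (fun=> 0) => [[]//|]; move: p0; rewrite [p]mpoly0_const mevalC.
  by apply: contra_neq => ->; rewrite mpolyC0.
have q0 : split_last p != 0.
  by apply: contra_neq p0 => e; apply: split_last_inj; rewrite e rmorph0.
have l0 : lead_coef (split_last p) != 0 by rewrite lead_coef_eq0.
have [w Sw lw] := IHn _ l0.
have r0 : map_poly (meval w) (split_last p) != 0.
  by rewrite -lead_coef_eq0 lead_coef_map_eq.
have [x Sx px] := infinite_nonroot Sinf r0.
exists (fun i => if unlift ord_max i is Some j then w j else x) => [i|].
  by case: unlift.
rewrite -split_last_horner unlift_none.
rewrite (@eq_map_poly _ _ _ (meval w)) // => q.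
by apply: meval_eq => j; rewrite liftK.
Qed.

End NonRoot.

Section PolyFun.
Variables (K : fieldType) (T : Type) (N : nat) (coord : 'I_N -> T -> K).
Implicit Types f g : T -> K.

(** The domain is any type with chosen coordinates, so that the same closure properties serve
    points, configurations in C^n and vectors of distances. *)
Definition polyfun f := exists h : {mpoly K[N]}, forall t, f t = h.@[fun i => coord i t].

Lemma polyfun_eq f g : f =1 g -> polyfun f -> polyfun g.
Proof. by move=> fg [h hE]; exists h => t; rewrite -fg. Qed.

Lemma polyfun_cst a : polyfun (fun=> a).
Proof. by exists a%:MP => t; rewrite mevalC. Qed.

Lemma polyfun_coord i : polyfun (coord i).
Proof. by exists 'X_i => t; rewrite mevalXU. Qed.

Lemma polyfunD f g : polyfun f -> polyfun g -> polyfun (fun t => f t + g t).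
Proof. by move=> [h hE] [k kE]; exists (h + k) => t; rewrite mevalD hE kE. Qed.

Lemma polyfunM f g : polyfun f -> polyfun g -> polyfun (fun t => f t * g t).
Proof. by move=> [h hE] [k kE]; exists (h * k) => t; rewrite mevalM hE kE. Qed.

Lemma polyfunN f : polyfun f -> polyfun (fun t => - f t).
Proof. by move=> [h hE]; exists (- h) => t; rewrite mevalN hE. Qed.

Lemma polyfunB f g : polyfun f -> polyfun g -> polyfun (fun t => f t - g t).
Proof. by move=> pf pg; apply: polyfunD => //; apply: polyfunN. Qed.

Lemma polyfunX f k : polyfun f -> polyfun (fun t => f t ^+ k).
Proof. by move=> [h hE]; exists (h ^+ k) => t; rewrite rmorphXn /= hE. Qed.

Lemma polyfun_sum (I : Type) (r : seq I) (P : pred I) (F : I -> T -> K) :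
  (forall i, P i -> polyfun (F i)) -> polyfun (fun t => \sum_(i <- r | P i) F i t).
Proof.
move=> pF; elim: r => [|i r IHr].
  by apply: polyfun_eq (polyfun_cst 0) => t; rewrite big_nil.
case Pi : (P i); last by apply: polyfun_eq IHr => t; rewrite big_cons Pi.
by apply: polyfun_eq (polyfunD (pF i Pi) IHr) => t; rewrite big_cons Pi.
Qed.

Lemma polyfun_meval n (p : {mpoly K[n]}) (F : 'I_n -> T -> K) :
  (forall i, polyfun (F i)) -> polyfun (fun t => p.@[fun i => F i t]).
Proof.
move=> /choice [h hE]; exists (p \mPo [tuple h i | i < n]) => t.
by rewrite comp_mpoly_meval; apply: meval_eq => i; rewrite tnth_mktuple hE.
Qed.

(** Later the restriction of a polynomial to a line that moves with [t], the auxiliary variable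
    being the parameter of the line. *)
Definition polyfam (F : T -> {poly K}) := forall k, polyfun (fun t => (F t)`_k).

Lemma polyfam_eq F G : F =1 G -> polyfam F -> polyfam G.
Proof. by move=> FG pF k; apply: polyfun_eq (pF k) => t; rewrite FG. Qed.

Lemma polyfamC f : polyfun f -> polyfam (fun t => (f t)%:P).
Proof.
move=> pf [|k]; first by apply: polyfun_eq pf => t; rewrite coefC.
by apply: polyfun_eq (polyfun_cst 0) => t; rewrite coefC.
Qed.

Lemma polyfamcst p : polyfam (fun=> p).
Proof. by move=> k; apply: polyfun_cst. Qed.

Lemma polyfamD F G : polyfam F -> polyfam G -> polyfam (fun t => F t + G t).
Proof.
by move=> pF pG k; apply: polyfun_eq (polyfunD (pF k) (pG k)) => t; rewrite coefD.
Qed.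

Lemma polyfamM F G : polyfam F -> polyfam G -> polyfam (fun t => F t * G t).
Proof.
move=> pF pG k.
apply: (@polyfun_eq (fun t => \sum_(j < k.+1) (F t)`_j * (G t)`_(k - j))).
  by move=> t; rewrite coefM.
by apply: polyfun_sum => j _; apply: polyfunM.
Qed.

Lemma polyfamX F k : polyfam F -> polyfam (fun t => F t ^+ k).
Proof.
move=> pF; elim: k => [|k IHk]; first exact: polyfam_eq (polyfamcst 1).
by apply: polyfam_eq (polyfamM pF IHk) => t; rewrite exprS.
Qed.

Lemma polyfam_mmap n (p : {mpoly K[n]}) (F : 'I_n -> T -> {poly K}) :
  (forall i, polyfam (F i)) -> polyfam (fun t => mmap polyC (fun i => F i t) p).
Proof.
move=> pF; rewrite /mmap; elim: (msupp p) => [|m s IHs].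
  by apply: polyfam_eq (polyfamcst 0) => t; rewrite big_nil.
apply: (@polyfam_eq (fun t => (p@_m)%:P * mmap1 (fun i => F i t) m +
    \sum_(m <- s) (p@_m)%:P * mmap1 (fun i => F i t) m)).
  by move=> t; rewrite big_cons.
apply: polyfamD => //; apply: polyfamM; first exact: polyfamcst.
rewrite /mmap1; elim: (index_enum _) => [|i r IHr].
  by apply: polyfam_eq (polyfamcst 1) => t; rewrite big_nil.
apply: polyfam_eq (polyfamM (polyfamX (m i) (pF i)) IHr) => t.
by rewrite big_cons.
Qed.

End PolyFun.

Lemma polyfun_comp (K : fieldType) (T T' : Type) (N N' : nat)
    (coord : 'I_N -> T -> K) (coord' : 'I_N' -> T' -> K) (phi : T -> T') f :
  (forall i, polyfun coord (coord' i \o phi)) -> polyfun coord' f ->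
  polyfun coord (f \o phi).
Proof.
move=> pphi [h hE]; apply: polyfun_eq (polyfun_meval h pphi) => t.
by rewrite /= hE.
Qed.

(** * Algebraic dependence on powers of a curve *)

Section Spanning.
Variables (K : fieldType) (T : Type) (A : set T).

Definition spanned (I : finType) (phi : I -> T -> K) (f : T -> K) :=
  exists c : I -> K, forall t, A t -> f t = \sum_i c i * phi i t.

Lemma spanned_sum (I : finType) (phi : I -> T -> K) (J : eqType) (s : seq J)
    (a : J -> K) (f : J -> T -> K) : (forall j, j \in s -> spanned phi (f j)) ->
  spanned phi (fun t => \sum_(j <- s) a j * f j t).
Proof.
move=> sf; have /choice [c cE] : forall j, exists c : I -> K, j \in s ->
    forall t, A t -> f j t = \sum_i c i * phi i t.
  move=> j; have [/sf [c cE]|_] := boolP (j \in s); last by exists (fun=> 0).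
  by exists c.
exists (fun i => \sum_(j <- s) a j * c j i) => t At.
rewrite (eq_big_seq (fun j => \sum_i a j * (c j i * phi i t))) => [|j js]; last first.
  by rewrite cE // mulr_sumr.
rewrite exchange_big; apply: eq_bigr => i _.
by rewrite mulr_suml; apply: eq_bigr => j _; rewrite mulrA.
Qed.

Lemma spanned_basis (I : finType) (phi : I -> T -> K) i : spanned phi (phi i).
Proof.
exists (fun j => (j == i)%:R) => t _.
rewrite (bigD1 i) //= eqxx mul1r big1 ?addr0 // => j /negPf ->.
by rewrite mul0r.
Qed.

Lemma spanned_dependent (I M : finType) (phi : I -> T -> K) (f : M -> T -> K) :
  (#|I| < #|M|)%N -> (forall m, spanned phi (f m)) ->
  exists e : M -> K, (exists m, e m != 0) /\
    forall t, A t -> \sum_m e m * f m t = 0.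
Proof.
move=> lt_IM /choice [c cE].
pose B : 'M[K]_(#|M|, #|I|) := \matrix_(m, i) c (enum_val m) (enum_val i).
have : kermx B != 0.
  rewrite kermx_eq0 /row_free neq_ltn (leq_ltn_trans (rank_leq_col B)) //.
case/rowV0Pn => u /sub_kermxP uB u0.
have /rV0Pn [m um] := u0; exists (fun m => u 0 (enum_rank m)); split.
  by exists (enum_val m); rewrite enum_valK.
move=> t At; under eq_bigr do rewrite cE // mulr_sumr.
rewrite exchange_big big1 // => i _.
have := congr1 (fun w : 'rV_ _ => w 0 (enum_rank i)) uB; rewrite !mxE => e.
under eq_bigr do rewrite mulrA; rewrite -mulr_suml.
suff -> : \sum_m u 0 (enum_rank m) * c m i = 0 by rewrite mul0r.
rewrite -[RHS]e (reindex (@enum_val M predT)) /=; last exact: (onW_bij _ (@enum_val_bij M)).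
by apply: eq_bigr => j _; rewrite enum_valK mxE enum_rankK.
Qed.
End Spanning.

Section MSize.
Variables (R : idomainType) (n : nat).
Implicit Types p q : {mpoly R[n]}.

Lemma msizeM_bound p q a b : (msize p <= a.+1)%N -> (msize q <= b.+1)%N ->
  (msize (p * q) <= (a + b).+1)%N.
Proof.
move=> pa qb; have [->|p0] := eqVneq p 0; first by rewrite mul0r msize0.
have [->|q0] := eqVneq q 0; first by rewrite mulr0 msize0.
rewrite msizeM //; move: (leq_add pa qb); rewrite addSn addnS.
by case: (_ + _)%N => //= k; rewrite ltnS.
Qed.

Lemma msizeX_bound p a k : (msize p <= a.+1)%N -> (msize (p ^+ k) <= (k * a).+1)%N.
Proof.
move=> pa; elim: k => [|k IHk]; first by rewrite expr0 msize1.
by rewrite exprS mulSn msizeM_bound.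
Qed.

Lemma msize_prod_bound (I : Type) (s : seq I) (F : I -> {mpoly R[n]}) a :
  (forall i, (msize (F i) <= a.+1)%N) -> (msize (\prod_(i <- s) F i) <= (size s * a).+1)%N.
Proof.
move=> Fa; elim: s => [|i s IHs]; first by rewrite big_nil msize1.
by rewrite big_cons mulSn msizeM_bound.
Qed.
End MSize.

Lemma mlead_cancel (R : comNzRingType) n (p r : {mpoly R[n]}) :
  mlead r = mlead p -> r@_(mlead p) = p@_(mlead p) -> p - r != 0 ->
  (mlead (p - r) < mlead p)%O.
Proof.
move=> lr cr pr0; rewrite Order.POrderTheory.lt_neqAle; apply/andP; split.
  apply: contraNneq pr0 => lE; rewrite -mleadc_eq0 lE mcoeffB cr subrr.
  exact: eqxx.
apply: Order.POrderTheory.le_trans (mleadB_le _ _) _.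
by rewrite lr Order.JoinTheory.joinxx.
Qed.

Lemma msize_mlead_le (R : nzRingType) n (p q : {mpoly R[n]}) : q != 0 ->
  (mlead p <= mlead q)%O -> (msize p <= msize q)%N.
Proof.
move=> q0 pq; have [->|p0] := eqVneq p 0; first by rewrite msize0.
by rewrite -(mlead_deg p0) -(mlead_deg q0) ltnS lemc_mdeg.
Qed.

(** * Reduction modulo F and the count of monomials *)

Section Reduction.
Variables (K : fieldType) (n : nat) (F : {mpoly K[n]}).
Hypothesis F_neq0 : F != 0.

(* Division by [F] for the graded monomial order. *)
Lemma reduce_monomials (p : {mpoly K[n]}) : exists h : {mpoly K[n]},
  [/\ (msize h <= msize p)%N,
      forall m, h@_m != 0 -> ~~ (mlead F <= m)%MM &
      forall v, F.@[v] = 0 -> p.@[v] = h.@[v]].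
Proof.
elim/mleadrect: p => p IHp.
have [->|p0] := eqVneq p 0.
  by exists 0; split=> // m; rewrite mcoeff0 eqxx.
pose m := mlead p; pose a := p@_m.
have a0 : a != 0 by rewrite mleadc_eq0.
(* [r] cancels the leading term of [p], and [k] is a reduced polynomial with the same values on the
   zeros of [F]: the leading term itself, or 0 when [r] is a multiple of [F]. *)
have [r [k [lr cr rk kred ksize]]] : exists r k : {mpoly K[n]},
    [/\ mlead r = m, r@_m = a, forall v, F.@[v] = 0 -> r.@[v] = k.@[v],
        forall m, k@_m != 0 -> ~~ (mlead F <= m)%MM & (msize k <= msize p)%N].
  have [lm|lm] := boolP (mlead F <= m)%MM; last first.
    exists (a *: 'X_[m]), (a *: 'X_[m]); split=> //.
    - by rewrite mleadZ // mleadXm.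
    - by rewrite mcoeffZ mcoeffX eqxx mulr1.
    - move=> m'; rewrite mcoeffZ mcoeffX; have [<- _ //|_] := eqVneq m m'.
      by rewrite mulr0 eqxx.
    - by rewrite msizeZ // msizeX mlead_deg.
  have b0 : a / F@_(mlead F) != 0 by rewrite mulf_neq0 ?invr_eq0 ?mleadc_eq0.
  exists ((a / F@_(mlead F)) *: (F * 'X_[m - mlead F])), 0; split=> //.
  - rewrite mleadZ // mleadM -?msize_poly_eq0 ?msizeX // ?msize_poly_eq0 // mleadXm.
    by rewrite addmC submK.
  - by rewrite mcoeffZ -{1}(submK lm) mcoeffMX divfK ?mleadc_eq0.
  - by move=> v Fv; rewrite mevalZ mevalM Fv mul0r mulr0 meval0.
  - by move=> m'; rewrite mcoeff0 eqxx.
  - by rewrite msize0.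
have [q0|q0] := eqVneq (p - r) 0.
  by exists k; split=> // v Fv; rewrite -rk // -[p](subrK r) q0 add0r.
have lq := mlead_cancel lr cr q0.
have [h [hs hred hE]] := IHp _ lq.
exists (k + h); split.
- rewrite (leq_trans (msizeD_le _ _)) // geq_max ksize /= (leq_trans hs) //.
  by apply: msize_mlead_le => //; apply: Order.POrderTheory.ltW.
- move=> m'; rewrite mcoeffD => nz.
  have [k0|/kred//] := eqVneq k@_m' 0.
  by apply: hred; rewrite k0 add0r in nz.
- by move=> v Fv; rewrite mevalD -rk // -hE // -mevalD addrC subrK.
Qed.
End Reduction.

Lemma prod_mxvec (S : comNzRingType) (k : nat) (G : 'I_(k * 2) -> S) :
  \prod_e G e = \prod_j (G (mxvec_index j 0) * G (mxvec_index j 1)).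
Proof.
rewrite (reindex _ (curry_mxvec_bij _ _)) /=.
rewrite (eq_bigr (fun p => G (mxvec_index p.1 p.2))) => [|[]//].
rewrite -(pair_bigA _ (fun j i => G (mxvec_index j i))) /=.
by apply: eq_bigr => j _; rewrite big_ord_recl big_ord1; congr (_ * G (mxvec_index _ _));
  apply: val_inj.
Qed.

Definition mxcoord (K : fieldType) (n : nat) (e : 'I_(n * 2)) (P : 'M[K]_(n, 2)) :=
  mxvec P 0 e.

Section Dependence.
Variables (K : fieldType) (F : {mpoly K[2]}).
Hypothesis F_neq0 : F != 0.
Let C := zeros [set F].

(** Indexes the monomials not divisible by the leading monomial of [F]: one exponent is below that
    of [mlead F], the other is at most [N]. Some occur twice; what matters is that their number is
    linear in [N]. *)
Definition reduced_index N : finType :=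
  (('I_(mlead F 0) * 'I_N.+1) + ('I_(mlead F 1) * 'I_N.+1))%type.

Definition reduced_fun N (j : reduced_index N) (v : 'rV[K]_2) : K :=
  match j with
  | inl ab => v 0 0 ^+ ab.1 * v 0 1 ^+ ab.2
  | inr ab => v 0 0 ^+ ab.2 * v 0 1 ^+ ab.1
  end.

Lemma card_reduced_index N :
  #|reduced_index N| = ((mlead F 0%R + mlead F 1%R) * N.+1)%N.
Proof. by rewrite card_sum !card_prod !card_ord mulnDl. Qed.

Lemma reduced_span N (p : {mpoly K[2]}) : (msize p <= N.+1)%N ->
  spanned C (@reduced_fun N) (fun v => p.@[fun i => v 0 i]).
Proof.
move=> pN; have [h [hs hred hE]] := reduce_monomials F_neq0 p.
have [c cE] : spanned C (@reduced_fun N) (fun v =>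
    \sum_(m <- msupp h) h@_m * (v 0 0 ^+ m 0 * v 0 1 ^+ m 1)).
  apply: (@spanned_sum _ _ _ _ _ _ (msupp h) (fun m => h@_m)
    (fun (m : 'X_{1..2}) (v : 'rV[K]_2) => v 0 0 ^+ m 0 * v 0 1 ^+ m 1)) => m mh.
  have mN : (m 0%R + m 1%R <= N)%N.
    have := leq_trans (msize_mdeg_lt mh) (leq_trans hs pN).
    rewrite ltnS mdegE big_ord_recl big_ord1.
    by congr (_ + m _ <= _)%N; apply: val_inj.
  have m0N : (m 0%R < N.+1)%N by rewrite ltnS (leq_trans _ mN) // leq_addr.
  have m1N : (m 1%R < N.+1)%N by rewrite ltnS (leq_trans _ mN) // leq_addl.
  have : ~~ (mlead F <= m)%MM by apply: hred; rewrite -mcoeff_msupp.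
  have [l0|l0 _] := leqP (mlead F 0) (m 0); last first.
    exact: (spanned_basis C _ (inl (Ordinal l0, Ordinal m1N))).
  have [l1|l1 _] := leqP (mlead F 1) (m 1); last first.
    exact: (spanned_basis C _ (inr (Ordinal l1, Ordinal m0N))).
  by case/mnm_lepP => i; case: (ord2P i) => ->.
exists c => v Cv; rewrite -cE // hE; last exact: Cv.
rewrite mevalE; apply: eq_bigr => m _; rewrite big_ord_recl big_ord1.
by congr (_ * (_ * v 0 _ ^+ m _)); apply: val_inj.
Qed.

(** A monomial in the coordinates of [k] points is a product over the points, and each factor is
    reduced separately. Bounding both exponents of a point by [N] gives the degree [N + N]. *)
Lemma power_span k N (p : {mpoly K[k * 2]}) : (msize p <= N.+1)%N ->
  spanned (cpow C k) (fun (a : {ffun 'I_k -> reduced_index (N + N)}) P =>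
      \prod_j reduced_fun (a j) (row j P))
    (fun P => p.@[fun e => mxcoord e P]).
Proof.
move=> pN.
have [c cE] : spanned (cpow C k) (fun (a : {ffun 'I_k -> reduced_index (N + N)}) P =>
      \prod_j reduced_fun (a j) (row j P))
   (fun P => \sum_(m <- msupp p) p@_m * \prod_e mxcoord e P ^+ m e).
  apply: (@spanned_sum _ _ _ _ _ _ (msupp p) (fun m => p@_m)
    (fun (m : 'X_{1..(k * 2)}) (P : 'M[K]_(k, 2)) => \prod_e mxcoord e P ^+ m e)) => m mp.
  have mN e : (m e <= N)%N.
    have := leq_trans (msize_mdeg_lt mp) pN.
    by rewrite ltnS mdegE => /(leq_trans _) -> //; rewrite (bigD1 e) //= leq_addr.
  have /choice [c cE] : forall j, spanned C (@reduced_fun (N + N)) (fun v =>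
      v 0 0 ^+ m (mxvec_index j 0) * v 0 1 ^+ m (mxvec_index j 1)).
    move=> j; pose q : {mpoly K[2]} :=
      'X_0 ^+ m (mxvec_index j 0) * 'X_1 ^+ m (mxvec_index j 1).
    have : (msize q <= (N + N).+1)%N.
      apply: msizeM_bound; apply: (leq_trans (msizeX_bound (a := 1) _ _));
        by rewrite ?msizeX ?mdeg1 // muln1 ltnS mN.
    case/reduced_span => c cE; exists c => v Cv; rewrite -cE //.
    by rewrite /q rmorphM !rmorphXn /= !mevalXU.
  exists (fun a : {ffun 'I_k -> reduced_index (N + N)} => \prod_j c j (a j)) => P CP.
  rewrite prod_mxvec (eq_bigr (fun j => \sum_i c j i * reduced_fun i (row j P))).
    by rewrite bigA_distr_bigA; apply: eq_bigr => a _; rewrite big_split.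
  by move=> j _; rewrite -(cE j _ (CP j)) /mxcoord !mxvecE !mxE.
by exists c => P CP; rewrite -cE // mevalE.
Qed.

(** The (N + 1)^(k + 1) power products of the [f i] with exponents at most [N] lie in the span of at
    most (B (N + 1))^k products of reduced monomials. For N = B^k this is N (N + 1)^k, which is
    smaller. *)
Lemma curve_power_dependent k (f : 'I_k.+1 -> 'M[K]_(k, 2) -> K) :
  (forall i, polyfun (@mxcoord K k) (f i)) ->
  exists Q : {mpoly K[k.+1]}, Q != 0 /\
    forall P, cpow C k P -> Q.@[fun i => f i P] = 0.
Proof.
case/choice => h hE; pose D := \max_i msize (h i).
have hD i : (msize (h i) <= D.+1)%N by rewrite leqW // /D (leq_bigmax i).
pose L := (mlead F 0%R + mlead F 1%R)%N.
(* A power product has degree at most [k.+1 * (N * D)], doubled by [power_span]; [B * N.+1] then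
   bounds the number of reduced monomials at each point. *)
pose B := (L * (k.+1 * D + k.+1 * D).+1)%N; pose N := (B ^ k)%N.
pose p (M : {ffun 'I_k.+1 -> 'I_N.+1}) := \prod_i h i ^+ M i.
have ps M : (msize (p M) <= (k.+1 * (N * D)).+1)%N.
  rewrite /p; have := @msize_prod_bound _ _ _ (index_enum 'I_k.+1)
    (fun i => h i ^+ M i) (N * D)%N.
  rewrite /index_enum -enumT size_enum_ord; apply => i.
  apply: (leq_trans (msizeX_bound (a := D) _ (hD i))).
  by rewrite ltnS leq_mul2r -ltnS ltn_ord orbT.
have [|e [[M eM] eE]] := spanned_dependent _ (fun M => power_span (ps M)).
  rewrite !card_ffun card_reduced_index !card_ord -/L.
  apply: (@leq_ltn_trans ((B * N.+1) ^ k)).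
    have mono a b : (a <= b)%N -> (a ^ k <= b ^ k)%N.
      by case: (k) => // k' ab; rewrite leq_exp2r.
    apply: mono; rewrite /B -mulnA leq_mul2l; apply/orP; right.
    have -> : (k.+1 * (N * D) = k.+1 * D * N)%N by rewrite -mulnA [(D * N)%N]mulnC.
    by move: (k.+1 * D)%N => X; nia.
  by rewrite expnMn expnS ltn_mul2r expn_gt0 ltnS leqnn.
exists (\sum_M e M *: 'X_[[multinom nat_of_ord (M i) | i < k.+1]]); split.
  apply/eqP => /(congr1 (mcoeff [multinom nat_of_ord (M i) | i < k.+1])).
  rewrite mcoeff0 raddf_sum /= (bigD1 M) //= mcoeffZ mcoeffX eqxx mulr1.
  rewrite big1 ?addr0 => [/eqP|M' nM]; first by rewrite (negPf eM).
  rewrite mcoeffZ mcoeffX; case: eqP; rewrite ?mulr0 // => /mnmP MM.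
  case/eqP: nM; apply/ffunP => i; apply: val_inj.
  by have := MM i; rewrite !mnmE.
move=> P CP; rewrite -[RHS](eE P CP) raddf_sum; apply: eq_bigr => M' _ /=.
rewrite mevalZ mevalX /p rmorph_prod; congr (_ * _); apply: eq_bigr => i _.
by rewrite mnmE hE rmorphXn.
Qed.
End Dependence.

Lemma numDomain_infinite (R : numDomainType) : infinite_set [set: R].
Proof.
move=> fin; apply: infinite_nat.
apply: (@finite_preimage _ _ setT (fun n : nat => n%:R : R)) fin => //.
by move=> m n _ _ /eqP; rewrite eqr_nat => /eqP.
Qed.

Definition rowcoord (K : fieldType) m (i : 'I_m) (v : 'rV[K]_m) := v 0 i.

Lemma polyfun_mxentry (K : fieldType) n i j : polyfun (@mxcoord K n) (fun P => P i j).
Proof.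
by apply: polyfun_eq (polyfun_coord _ (mxvec_index i j)) => P; rewrite /mxcoord mxvecE.
Qed.

Lemma polyfun_mxcomp (K : fieldType) (T : Type) N (coord : 'I_N -> T -> K) n
    (M : T -> 'M[K]_(n, 2)) f :
  (forall i j, polyfun coord (fun t => M t i j)) -> polyfun (@mxcoord K n) f ->
  polyfun coord (fun t => f (M t)).
Proof.
move=> pM pf; apply: (@polyfun_comp _ _ _ _ _ _ _ M f _ pf) => e.
case/mxvec_indexP: e => i j.
by apply: polyfun_eq (pM i j) => t; rewrite /mxcoord /= mxvecE.
Qed.

Lemma polyfun_rowcomp (K : fieldType) (T : Type) N (coord : 'I_N -> T -> K) n
    (M : T -> 'rV[K]_n) f :
  (forall j, polyfun coord (fun t => M t 0 j)) -> polyfun (@rowcoord K n) f ->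
  polyfun coord (fun t => f (M t)).
Proof. by move=> pM pf; apply: (@polyfun_comp _ _ _ _ _ _ _ M f _ pf). Qed.

Definition setrow (K : Type) n m (P : 'M[K]_(n, m)) k (v : 'rV[K]_m) : 'M[K]_(n, m) :=
  \matrix_(i, j) if i == k then v 0 j else P i j.

Lemma row_setrow (K : Type) n m (P : 'M[K]_(n, m)) k v i :
  row i (setrow P k v) = if i == k then v else row i P.
Proof. by apply/rowP => j; rewrite !mxE; case: eqP => //; rewrite !mxE. Qed.

Lemma polyfun_setrow (K : fieldType) n (P : 'M[K]_(n, 2)) k i j :
  polyfun (@rowcoord K 2) (fun v => setrow P k v i j).
Proof.
have [ik|ik] := eqVneq i k.
  by apply: polyfun_eq (polyfun_coord _ j) => v; rewrite mxE ik eqxx.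
by apply: polyfun_eq (polyfun_cst _ (P i j)) => v; rewrite mxE (negPf ik).
Qed.

Lemma setrow_id (K : Type) n m (P : 'M[K]_(n, m)) k : setrow P k (row k P) = P.
Proof. by apply/row_matrixP => i; rewrite row_setrow; case: eqP => [->|]. Qed.

Lemma cpow_setrow (K : fieldType) (C : set 'rV[K]_2) n (P : 'M[K]_(n, 2)) k v :
  cpow C n P -> C v -> cpow C n (setrow P k v).
Proof. by move=> CP Cv j; rewrite row_setrow; case: eqP. Qed.

(** * Polynomial functions on the curve and on its powers *)

Section Curve.
Variables (K : numClosedFieldType) (F : {mpoly K[2]}).
Hypothesis F_irr : mirreducible F.
Hypothesis F_deg : (2 < msize F)%N.
Let C := zeros [set F].

Lemma curveP (v : 'rV[K]_2) : C v <-> F.@[fun i => v 0 i] = 0.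
Proof. by split=> [|Fv f ->//]; apply. Qed.

Lemma curve_infinite : infinite_set C.
Proof.
move=> Cfin; apply: (@numDomain_infinite K).
have [s sP] := curve_abscissa_cofinite F_irr F_deg.
apply: (@sub_finite_set _ _ ([set` s] `|` [set v 0 0 | v in C])).
  move=> x _; have [xs|/sP [v Fv vx]] := boolP (x \in s); first by left.
  by right; exists v => //; apply/curveP.
rewrite finite_setU; split; first exact: finite_seq.
exact: finite_image.
Qed.

Lemma curve_zero_finite f : polyfun (@rowcoord K 2) f ->
  (exists2 v, C v & f v != 0) -> finite_set [set v | C v /\ f v = 0].
Proof.
move=> [h hE] [v Cv fv]; have := @curve_inter_finite _ _ F_irr F_deg h.
case; first by case=> D hD; case/eqP: fv; rewrite hE hD mevalM (Cv F) // mul0r.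
move=> n bij; apply: (@sub_finite_set _ _
  [set v : 'rV[K]_2 | F.@[fun i => v 0 i] = 0 /\ h.@[fun i => v 0 i] = 0]); last by exists n.
by move=> w [/curveP Cw fw]; split=> //; rewrite -fw hE.
Qed.

(** In other terms, infinite subsets of [C] are Zariski dense in it; this is applied to orbits. *)
Lemma curve_vanish f (A : set 'rV[K]_2) : polyfun (@rowcoord K 2) f ->
  infinite_set A -> A `<=` C -> (forall v, A v -> f v = 0) -> forall v, C v -> f v = 0.
Proof.
move=> pf Ainf AC fA v Cv; apply: contrapT => /eqP fv; apply: Ainf.
apply: sub_finite_set (curve_zero_finite pf _); last by exists v.
by move=> w Aw; split; [exact: AC | exact: fA].
Qed.

Lemma curve_prime f g : polyfun (@rowcoord K 2) f -> polyfun (@rowcoord K 2) g ->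
  (exists2 v, C v & f v != 0) -> (exists2 v, C v & g v != 0) ->
  exists v, [/\ C v, f v != 0 & g v != 0].
Proof.
move=> pf pg /(curve_zero_finite pf) finf /(curve_zero_finite pg) fing.
apply: contrapT => h; apply: curve_infinite.
apply: (@sub_finite_set _ _ ([set v | C v /\ f v = 0] `|` [set v | C v /\ g v = 0])).
  move=> v Cv; have [fv|fv] := eqVneq (f v) 0; first by left.
  have [gv|gv] := eqVneq (g v) 0; first by right.
  by case: h; exists v.
by rewrite finite_setU.
Qed.

(* Rows are moved one at a time, [C] being infinite and a nonzero function
   having finitely many zeros on it. *)
Lemma curve_power_prime n (f g : 'M[K]_(n, 2) -> K) :
  polyfun (@mxcoord K n) f -> polyfun (@mxcoord K n) g ->
  (exists2 P, cpow C n P & f P != 0) -> (exists2 P, cpow C n P & g P != 0) ->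
  exists P, [/\ cpow C n P, f P != 0 & g P != 0].
Proof.
move=> pf pg [P0 CP0 fP0] [Q0 CQ0 gQ0].
have pfset P k := polyfun_mxcomp (polyfun_setrow P k) pf.
have pgset P k := polyfun_mxcomp (polyfun_setrow P k) pg.
(* Two configurations are kept, one with [f] nonzero and one with [g] nonzero; their rows are made
   equal in turn, by a point of [C] that is good for both. *)
have step k : (k <= n)%N -> exists P Q, [/\ cpow C n P, cpow C n Q, f P != 0, g Q != 0
    & forall i : 'I_n, (i < k)%N -> row i P = row i Q].
  elim: k => [|k IHk] kn; first by exists P0, Q0; split.
  have [P [Q [CP CQ fP gQ PQ]]] := IHk (ltnW kn); pose k' := Ordinal kn.
  have [||v [Cv fv gv]] := curve_prime (pfset P k') (pgset Q k').
  - by exists (row k' P); rewrite ?setrow_id.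
  - by exists (row k' Q); rewrite ?setrow_id.
  exists (setrow P k' v), (setrow Q k' v); split; try exact: cpow_setrow; try by [].
  move=> i ik; rewrite !row_setrow; case: eqP => // /eqP nik.
  apply: PQ; move: ik; rewrite ltnS leq_eqVlt => /orP[/eqP ik|//].
  by case/eqP: nik; apply: val_inj.
have [P [Q [CP CQ fP gQ PQ]]] := step n (leqnn n).
exists P; split=> //; suff -> : P = Q by [].
by apply/row_matrixP => i; apply: PQ.
Qed.

Lemma curve_not_in_line (l : {mpoly K[2]}) : l != 0 -> (msize l <= 2)%N -> ~ mdvd F l.
Proof.
move=> l0 ls [D e]; have D0 : D != 0 by apply: contra_neq l0 => D0; rewrite e D0 mulr0.
have F0 : F != 0 by case: F_irr.
have : (msize F <= msize l)%N.
  rewrite e msizeM // -subn1 -addnBA ?leq_addr //.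
  by rewrite lt0n msize_poly_eq0.
by rewrite leqNgt (leq_ltn_trans ls).
Qed.

Lemma line_not_in_curve (l : {mpoly K[2]}) : (msize l <= 2)%N ->
  l \isn't a GRing.unit -> forall D, F <> l * D.
Proof.
move=> ls lu D e; case: F_irr => _ _ /(_ _ _ e) [lu'|Du].
  by rewrite lu' in lu.
have l0 : l != 0.
  by apply/eqP => l0; move: F_deg; rewrite e l0 mul0r msize0.
have D0 : D != 0 by apply/eqP => D0; move: Du; rewrite D0 unitr0.
by move: F_deg; rewrite e msizeM // (msize_unit Du) addn1 /= ltnNge ls.
Qed.

End Curve.

(** * Euclidean motions and symmetries *)

Section EuclideanGroup.
Variable K : numClosedFieldType.
Implicit Types (g h : 'M[K]_3) (p q v w : 'rV[K]_2).

Lemma row2P v w : v 0 0 = w 0 0 -> v 0 1 = w 0 1 -> v = w.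
Proof. by move=> e0 e1; apply/rowP => j; case: (ord2P j) => ->. Qed.

Lemma act_mx g v : let e i := g i 0 * v 0 0 + g i 1 * v 0 1 + g i 2%:R in
  act g v 0 0 = e 0 /\ act g v 0 1 = e 1.
Proof.
have rl k : (row_mx v (1 : 'M[K]_1) : 'rV[K]_(2 + 1)) 0 (lshift 1 k) = v 0 k.
  exact: row_mxEl.
have r0 : (row_mx v (1 : 'M[K]_1) : 'rV[K]_(2 + 1)) 0 ord0 = v 0 0.
  by rewrite -rl; congr (row_mx _ _ _ _); apply: val_inj.
have r1 : (row_mx v (1 : 'M[K]_1) : 'rV[K]_(2 + 1)) 0 (lift ord0 ord0) = v 0 1.
  by rewrite -rl; congr (row_mx _ _ _ _); apply: val_inj.
have r2 : (row_mx v (1 : 'M[K]_1) : 'rV[K]_(2 + 1)) 0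
    (lift ord0 (lift ord0 ord0)) = 1.
  transitivity ((row_mx v (1 : 'M[K]_1) : 'rV[K]_(2 + 1)) 0 (rshift 2 0)).
    by congr (row_mx _ _ _ _); apply: val_inj.
  by rewrite row_mxEr mxE.
rewrite /act /= !mxE !big_ord_recl !big_ord0 r0 r1 r2 !mxE.
rewrite !addr0 !mul1r !addrA !(mulrC (v _ 0)) !(mulrC (v _ 1)).
by split; congr (g _ _ * _ + g _ _ * _ + g _ _); apply: val_inj.
Qed.

Lemma act1 v : act 1%:M v = v.
Proof.
have [e0 e1] := act_mx 1%:M v; apply: row2P; rewrite ?e0 ?e1 !mxE /=; ring.
Qed.

Lemma euclid_mxE (alpha c s a b : K) : let g := euclid_mx alpha c s a b in
  [/\ (g 0 0 = alpha * c), (g 0 1 = alpha * s), (g 0 2%:R = a),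
      (g 1 0 = - s) & (g 1 1 = c) ] /\
   [/\ g 1 2%:R = b, g 2%:R 0 = 0, g 2%:R 1 = 0 & g 2%:R 2%:R = 1].
Proof. by rewrite /euclid_mx !mxE. Qed.

Lemma ord3P (i : 'I_3) : [\/ i = 0, i = 1 | i = 2%:R].
Proof.
case: i => [[|[|[|//]]]] lti; [apply: Or31|apply: Or32|apply: Or33]; exact: val_inj.
Qed.

Lemma mx3P g h : (forall i j, i = 0 \/ i = 1 \/ i = 2%:R -> j = 0 \/ j = 1 \/ j = 2%:R ->
  g i j = h i j) -> g = h.
Proof.
move=> e; apply/matrixP => i j; apply: e.
  by case: (ord3P i); tauto.
by case: (ord3P j); tauto.
Qed.

Lemma mulmx3E g h i j : (g *m h) i j = g i 0 * h 0 j + g i 1 * h 1 j + g i 2%:R * h 2%:R j.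
Proof.
rewrite !mxE !big_ord_recl big_ord0 addr0 addrA.
by congr (g _ _ * h _ _ + g _ _ * h _ _ + g _ _ * h _ _); apply: val_inj.
Qed.

Lemma euclid1 : @euclid K 1%:M.
Proof.
exists 1, 1, 0, 0, 0; split; [by right | by ring |].
by apply: mx3P => i j [->|[->|->]] [->|[->|->]]; rewrite !mxE /=; ring.
Qed.

Lemma euclid_mul g h : euclid g -> euclid h -> euclid (g *m h).
Proof.
move=> [al [c [s [a [b [ha hc ->]]]]]] [be [c' [s' [a' [b' [hb hc' ->]]]]]].
have al2 : al ^+ 2 = 1 by case: ha => ->; ring.
have be2 : be ^+ 2 = 1 by case: hb => ->; ring.
exists (al * be), (c * c' - be * s * s'), (be * s * c' + c * s'),
  (al * (c * a' + s * b') + a), (- s * a' + c * b' + b); split.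
- by case: ha => ->; case: hb => ->; rewrite ?mul1r ?mulN1r ?opprK; tauto.
- transitivity ((c ^+ 2 + s ^+ 2) * (c' ^+ 2 + s' ^+ 2) +
    (be ^+ 2 - 1) * (s ^+ 2 * s' ^+ 2 + s ^+ 2 * c' ^+ 2)); first by ring.
  by rewrite hc hc' be2; ring.
have bb : be * be = 1 by rewrite -expr2.
apply: mx3P => i j [->|[->|->]] [->|[->|->]]; rewrite !mxE !big_ord_recl big_ord0 !mxE /=;
  case: hb => hb; rewrite ?hb; ring.
Qed.

(** [act] drops the last coordinate, so composition relies on the last row of [h] being (0, 0,
    1). *)
Lemma act_mul g h v : euclid h -> act (g *m h) v = act g (act h v).
Proof.
move=> [be [c [s [a [b [_ _ hE]]]]]].
have [_ [_ h0 h1 h2]] := euclid_mxE be c s a b; rewrite -hE in h0 h1 h2.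
have [e0 e1] := act_mx (g *m h) v; have [d0 d1] := act_mx g (act h v).
have [f0 f1] := act_mx h v.
by apply: row2P; rewrite ?e0 ?e1 ?d0 ?d1 f0 f1 !mulmx3E h0 h1 h2; ring.
Qed.

Lemma euclid_inv g : euclid g ->
  exists h, [/\ euclid h, g *m h = 1%:M & h *m g = 1%:M].
Proof.
move=> [al [c [s [a [b [ha hc ->]]]]]].
have al2 : al ^+ 2 = 1 by case: ha => ->; ring.
pose h := euclid_mx al c (- al * s) (- (al * c * a - s * b)) (- (al * s * a + c * b)).
have gh : euclid_mx al c s a b *m h = 1%:M.
  have hc2 : c ^+ 2 = 1 - s ^+ 2 by rewrite -hc addrK.
  have [[g00 g01 g02 g10 g11] [g12 g20 g21 g22]] := euclid_mxE al c s a b.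
  have [[h00 h01 h02 h10 h11] [h12 h20 h21 h22]] := euclid_mxE al c (- al * s)
    (- (al * c * a - s * b)) (- (al * s * a + c * b)).
  apply: mx3P => i j [->|[->|->]] [->|[->|->]]; rewrite mulmx3E
    ?(g00, g01, g02, g10, g11, g12, g20, g21, g22)
    ?(h00, h01, h02, h10, h11, h12, h20, h21, h22) mxE /=;
  by case: ha => ->; ring: hc2.
exists h; split=> //; last exact: mulmx1C.
exists al, c, (- al * s), (- (al * c * a - s * b)), (- (al * s * a + c * b)); split=> //.
by rewrite exprMn sqrrN al2 mul1r.
Qed.

Lemma sqdist_act g p q : euclid g -> sqdist (act g p) (act g q) = sqdist p q.
Proof.
move=> [al [c [s [a [b [ha hc gE]]]]]].
have al2 : al ^+ 2 = 1 by case: ha => ->; ring.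
have [p0 p1] := act_euclid al c s a b p; have [q0 q1] := act_euclid al c s a b q.
rewrite -gE in p0 p1 q0 q1; rewrite /sqdist p0 p1 q0 q1.
transitivity ((c ^+ 2 + s ^+ 2) * ((p 0 0 - q 0 0) ^+ 2 + (p 0 1 - q 0 1) ^+ 2) +
  (al ^+ 2 - 1) * (c * (p 0 0 - q 0 0) + s * (p 0 1 - q 0 1)) ^+ 2); first by ring.
by rewrite hc al2; ring.
Qed.

Lemma sqdistC p q : sqdist p q = sqdist q p.
Proof. by rewrite /sqdist -[p 0 0 - _]opprB -[p 0 1 - _]opprB !sqrrN. Qed.

(** Twice the signed area of the triangle; it vanishes exactly when q - p and v - p are linearly
    dependent. *)
Definition area p q v : K :=
  (q 0 0 - p 0 0) * (v 0 1 - p 0 1) - (q 0 1 - p 0 1) * (v 0 0 - p 0 0).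

(** With the orientation [al] fixed, sending q - p to w - v is a linear system in [c] and [s] whose
    determinant is, up to sign, the squared length: the formulas are Cramer's. The action is spelled
    out because [congruence] computes with it. *)
Lemma euclid_of_segment (al : K) p q v w : al = -1 \/ al = 1 ->
  sqdist p q = sqdist v w -> sqdist p q != 0 ->
  let c := (al * (w 0 0 - v 0 0) * (q 0 0 - p 0 0) +
            (w 0 1 - v 0 1) * (q 0 1 - p 0 1)) / sqdist p q in
  let s := (al * (w 0 0 - v 0 0) * (q 0 1 - p 0 1) -
            (w 0 1 - v 0 1) * (q 0 0 - p 0 0)) / sqdist p q in
  exists g, [/\ euclid g, act g p = v, act g q = w & forall r,
    act g r 0 0 = al * (c * (r 0 0 - p 0 0) + s * (r 0 1 - p 0 1)) + v 0 0 /\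
    act g r 0 1 = - s * (r 0 0 - p 0 0) + c * (r 0 1 - p 0 1) + v 0 1].
Proof.
move=> ha; set D := sqdist p q => e D0 c s.
have al2 : al ^+ 2 = 1 by case: ha => ->; ring.
have DE : D = (q 0 0 - p 0 0) ^+ 2 + (q 0 1 - p 0 1) ^+ 2.
  by rewrite /D sqdistC.
have De : D = (w 0 0 - v 0 0) ^+ 2 + (w 0 1 - v 0 1) ^+ 2.
  by rewrite e sqdistC.
have cD : c * D = al * (w 0 0 - v 0 0) * (q 0 0 - p 0 0) +
            (w 0 1 - v 0 1) * (q 0 1 - p 0 1) by rewrite divfK.
have sD : s * D = al * (w 0 0 - v 0 0) * (q 0 1 - p 0 1) -
            (w 0 1 - v 0 1) * (q 0 0 - p 0 0) by rewrite divfK.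
have cs : c ^+ 2 + s ^+ 2 = 1.
  apply: (mulIf (expf_neq0 2 D0)); rewrite mulrDl -!exprMn cD sD mul1r.
  transitivity ((al ^+ 2 * (w 0 0 - v 0 0) ^+ 2 + (w 0 1 - v 0 1) ^+ 2) *
    ((q 0 0 - p 0 0) ^+ 2 + (q 0 1 - p 0 1) ^+ 2)); first by ring.
  by rewrite al2 mul1r -De -DE -expr2.
pose g := euclid_mx al c s (v 0 0 - al * (c * p 0 0 + s * p 0 1))
                           (v 0 1 - (- s * p 0 0 + c * p 0 1)).
have gE r : act g r 0 0 = al * (c * (r 0 0 - p 0 0) + s * (r 0 1 - p 0 1)) + v 0 0 /\
    act g r 0 1 = - s * (r 0 0 - p 0 0) + c * (r 0 1 - p 0 1) + v 0 1.
  have [-> ->] := act_euclid al c s (v 0 0 - al * (c * p 0 0 + s * p 0 1))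
     (v 0 1 - (- s * p 0 0 + c * p 0 1)) r; by split; ring.
exists g; split=> //.
- by exists al, c, s, (v 0 0 - al * (c * p 0 0 + s * p 0 1)),
    (v 0 1 - (- s * p 0 0 + c * p 0 1)).
- by have [e0 e1] := gE p; apply: row2P; rewrite ?e0 ?e1 !subrr; ring.
have [e0 e1] := gE q; apply: row2P; rewrite ?e0 ?e1.
  rewrite -[RHS](subrK (v 0 0)); congr (_ + _); apply: (mulIf D0).
  transitivity (al * ((c * D) * (q 0 0 - p 0 0) + (s * D) * (q 0 1 - p 0 1))).
    by ring.
  rewrite cD sD.
  transitivity (al ^+ 2 * (w 0 0 - v 0 0) *
    ((q 0 0 - p 0 0) ^+ 2 + (q 0 1 - p 0 1) ^+ 2)); first by ring.
  by rewrite al2 mul1r -DE.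
rewrite -[RHS](subrK (v 0 1)); congr (_ + _); apply: (mulIf D0).
transitivity (- (s * D) * (q 0 0 - p 0 0) + (c * D) * (q 0 1 - p 0 1)).
  by ring.
rewrite cD sD.
transitivity ((w 0 1 - v 0 1) *
    ((q 0 0 - p 0 0) ^+ 2 + (q 0 1 - p 0 1) ^+ 2)); first by ring.
by rewrite -DE.
Qed.

Definition dotp p q v : K :=
  (q 0 0 - p 0 0) * (v 0 0 - p 0 0) + (q 0 1 - p 0 1) * (v 0 1 - p 0 1).

Lemma dotp_sqdist p q v :
  2%:R * dotp p q v = sqdist p q + sqdist p v - sqdist q v.
Proof. by rewrite /dotp /sqdist; ring. Qed.

Lemma dotp_congr p q v p' q' v' : sqdist p q = sqdist p' q' ->
  sqdist p v = sqdist p' v' -> sqdist q v = sqdist q' v' -> dotp p q v = dotp p' q' v'.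
Proof.
move=> e1 e2 e3; apply: (mulfI (_ : 2%:R != 0)); first by rewrite pnatr_eq0.
by rewrite !dotp_sqdist e1 e2 e3.
Qed.

(* Brahmagupta's identity, polarized *)
Lemma dotp_area p q v w : sqdist p q * dotp p v w =
  dotp p q v * dotp p q w + area p q v * area p q w.
Proof. by rewrite /dotp /area /sqdist; ring. Qed.

(** Relative to the base p0 p1, a point is given by a dot product and an area. Distances determine
    the dot products by polarization; they determine the area of the triangle up to a sign, which
    fixes the orientation of [g], and then any other area through its product with that one. *)
Lemma congruence p0 p1 p2 q0 q1 q2 : sqdist p0 p1 != 0 -> area p0 p1 p2 != 0 ->
  sqdist p0 p1 = sqdist q0 q1 -> sqdist p0 p2 = sqdist q0 q2 ->
  sqdist p1 p2 = sqdist q1 q2 ->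
  exists2 g, euclid g & forall r r', sqdist p0 r = sqdist q0 r' ->
    sqdist p1 r = sqdist q1 r' -> sqdist p2 r = sqdist q2 r' -> act g r = r'.
Proof.
move=> D0 A0 e01 e02 e12; have dot2 := dotp_congr e01 e02 e12.
have nrm p v : dotp p v v = sqdist p v by rewrite /dotp /sqdist; ring.
have [al ha areaE] : exists2 al : K, al = -1 \/ al = 1 &
    area q0 q1 q2 = al * area p0 p1 p2.
  have : area q0 q1 q2 ^+ 2 == area p0 p1 p2 ^+ 2.
    have := dotp_area p0 p1 p2 p2; have := dotp_area q0 q1 q2 q2.
    rewrite !nrm -e01 -e02 -dot2 => -> /addrI; rewrite !expr2 => ->.
    exact: eqxx.
  rewrite eqf_sqr => /orP[] /eqP ->; first by exists 1; [right | rewrite mul1r].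
  by exists (-1); [left | rewrite mulN1r].
have al2 : al * al = 1 by case: ha => ->; ring.
have [g [eg _ _ gE]] := euclid_of_segment ha e01 D0; exists g => // r r' f0 f1 f2.
have dotr := dotp_congr e01 f0 f1; have dotr2 := dotp_congr e02 f0 f2.
have areaR : area q0 q1 r' = al * area p0 p1 r.
  have := dotp_area p0 p1 p2 r; have := dotp_area q0 q1 q2 r'.
  rewrite -e01 -dotr2 -dotr -dot2 => -> /addrI; rewrite areaE => e.
  by apply: (mulfI A0); rewrite mulrCA -e !mulrA al2 mul1r.
have DE : sqdist p0 p1 = (q1 0 0 - q0 0 0) ^+ 2 + (q1 0 1 - q0 0 1) ^+ 2.
  by rewrite e01 sqdistC.
have [g0 g1] := gE r; apply: row2P; rewrite ?g0 ?g1.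
  rewrite -[RHS](subrK (q0 0 0)); congr (_ + _); apply: (mulIf D0).
  transitivity (al * al * (q1 0 0 - q0 0 0) * dotp p0 p1 r -
     (q1 0 1 - q0 0 1) * (al * area p0 p1 r)).
    by rewrite /dotp /area; field.
  by rewrite -areaR dotr al2 DE /dotp /area; ring.
rewrite -[RHS](subrK (q0 0 1)); congr (_ + _); apply: (mulIf D0).
transitivity ((q1 0 1 - q0 0 1) * dotp p0 p1 r +
     (q1 0 0 - q0 0 0) * (al * area p0 p1 r)).
  by rewrite /dotp /area; field.
by rewrite -areaR dotr DE /dotp /area; ring.
Qed.

(** An affine function vanishing at three non-collinear points is zero. This applies to the first
    two rows of g - h; the third is common to all motions. *)
Lemma euclid_eq g h p0 p1 p2 : euclid g -> euclid h -> area p0 p1 p2 != 0 ->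
  act g p0 = act h p0 -> act g p1 = act h p1 -> act g p2 = act h p2 -> g = h.
Proof.
move=> [al [c [s [a [b [_ _ gE]]]]]] [al' [c' [s' [a' [b' [_ _ hE]]]]]] A0 e0 e1 e2.
have [_ [_ g0 g1 g2]] := euclid_mxE al c s a b; rewrite -gE in g0 g1 g2.
have [_ [_ h0 h1 h2]] := euclid_mxE al' c' s' a' b'; rewrite -hE in h0 h1 h2.
have lin (x y z : K) : x * p0 0 0 + y * p0 0 1 + z = 0 ->
    x * p1 0 0 + y * p1 0 1 + z = 0 -> x * p2 0 0 + y * p2 0 1 + z = 0 ->
    [/\ x = 0, y = 0 & z = 0].
  move=> f0 f1 f2; have zE : z = - (x * p0 0 0 + y * p0 0 1).
    by apply/eqP; rewrite eq_sym eqr_oppLR -subr_eq0 opprK f0.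
  rewrite zE in f1 f2.
  have x0 : x = 0.
    apply: (mulIf A0); rewrite mul0r.
    transitivity ((p2 0 1 - p0 0 1) * (x * p1 0 0 + y * p1 0 1 - (x * p0 0 0 + y * p0 0 1)) -
      (p1 0 1 - p0 0 1) * (x * p2 0 0 + y * p2 0 1 - (x * p0 0 0 + y * p0 0 1))).
      by rewrite /area; ring.
    by rewrite f1 f2; ring.
  have y0 : y = 0.
    apply: (mulIf A0); rewrite mul0r.
    transitivity ((p1 0 0 - p0 0 0) * (x * p2 0 0 + y * p2 0 1 - (x * p0 0 0 + y * p0 0 1)) -
      (p2 0 0 - p0 0 0) * (x * p1 0 0 + y * p1 0 1 - (x * p0 0 0 + y * p0 0 1))).
      by rewrite /area; ring.
    by rewrite f1 f2; ring.
  by rewrite zE x0 y0; split=> //; ring.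
have sub3 (x y z x' y' z' u v : K) : x * u + y * v + z = x' * u + y' * v + z' ->
    (x - x') * u + (y - y') * v + (z - z') = 0.
  by move=> e; rewrite -(subrr (x * u + y * v + z)) {2}e; ring.
have rowE i : i = 0 \/ i = 1 -> [/\ g i 0 = h i 0, g i 1 = h i 1 & g i 2%:R = h i 2%:R].
  move=> i01; suff : [/\ g i 0 - h i 0 = 0, g i 1 - h i 1 = 0 & g i 2%:R - h i 2%:R = 0].
    by case=> /subr0_eq-> /subr0_eq-> /subr0_eq->.
  have eqi p : act g p = act h p -> g i 0 * p 0 0 + g i 1 * p 0 1 + g i 2%:R =
      h i 0 * p 0 0 + h i 1 * p 0 1 + h i 2%:R.
    move=> e; have [u0 u1] := act_mx g p; have [w0 w1] := act_mx h p.
    by case: i01 => ->; rewrite -?u0 -?w0 -?u1 -?w1 e.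
  by apply: lin; apply: sub3; apply: eqi.
apply: mx3P => i j [i0|[i1|->]].
- by have [// | ? ? ?] := rowE i; [left | case=> [->|[->|->]]].
- by have [// | ? ? ?] := rowE i; [right | case=> [->|[->|->]]].
by move=> [->|[->|->]]; rewrite ?g0 ?g1 ?g2 ?h0 ?h1 ?h2.
Qed.
End EuclideanGroup.

Lemma mpoly_ext (K : numClosedFieldType) n (f g : {mpoly K[n]}) :
  (forall v : 'I_n -> K, f.@[v] = g.@[v]) -> f = g.
Proof.
move=> fg; apply/eqP; rewrite -subr_eq0; apply/negPn/negP.
move=> /(mpoly_nonroot (@numDomain_infinite K)) [v _].
by rewrite mevalB fg subrr eqxx.
Qed.

Section PrimeFactors.
Variable K : closedFieldType.
Implicit Types G H : {mpoly K[2]}.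

Definition mprime G := forall A B, mdvd G (A * B) -> mdvd G A \/ mdvd G B.

(** Once one prime is cancelled, the others still divide the cofactor, and each cancellation lowers
    the degree by at least one. *)
Lemma prime_factors_lt_msize (n : nat) (G : 'I_n -> {mpoly K[2]}) H : H != 0 ->
  (forall i, [/\ mprime (G i), (1 < msize (G i))%N & mdvd (G i) H]) ->
  (forall i j, i != j -> ~ mdvd (G i) (G j)) -> (n < msize H)%N.
Proof.
elim: n G H => [|n IHn] G H H0 GP Gij; first by rewrite lt0n msize_poly_eq0.
have [_ G1 [D HE]] := GP ord0.
have G0 : G ord0 != 0 by rewrite -msize_poly_eq0 -lt0n (ltn_trans _ G1).
have D0 : D != 0 by apply: contra_neq H0; rewrite HE => ->; rewrite mulr0.
have : (n < msize D)%N.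
  apply: (IHn (fun i => G (lift ord0 i))) => // [i|i j ij]; last first.
    by apply: Gij; rewrite (inj_eq lift_inj).
  have [Gp Gs] := GP (lift ord0 i); rewrite HE => /Gp [Gi|]; last by split.
  by case: (Gij (lift ord0 i) ord0).
rewrite HE msizeM //; move: G1; case: (msize (G ord0)) => [//|[//|k]] _ nD.
by rewrite !addSn /= (leq_ltn_trans nD) // ltnS leq_addl.
Qed.
End PrimeFactors.

(** * Motions acting on polynomials, and the symmetries of the curve *)

Section Symmetries.
Variables (K : numClosedFieldType).
Implicit Types (g h : 'M[K]_3) (p q v w : 'rV[K]_2) (f : {mpoly K[2]}).

(** Composition with [g], which reverses products of motions; [act_poly g F] cuts out g^-1 C. *)
Definition act_poly g : {mpoly K[2]} -> {mpoly K[2]} :=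
  comp_mpoly [tuple let i : 'I_3 := if j == 0 then 0 else 1 in
    (g i 0)%:MP * 'X_0 + (g i 1)%:MP * 'X_1 + (g i 2%:R)%:MP | j < 2].

HB.instance Definition _ g := GRing.RMorphism.on (act_poly g).

Lemma act_polyE g f v : (act_poly g f).@[fun i => v 0 i] = f.@[fun i => act g v 0 i].
Proof.
rewrite /act_poly comp_mpoly_meval; apply: meval_eq => j.
have [e0 e1] := act_mx g v; rewrite tnth_mktuple !mevalD !mevalM !mevalC !mevalXU.
by case: (ord2P j) => ->; rewrite ?e0 ?e1.
Qed.

Lemma mpoly_rV_ext n (f1 f2 : {mpoly K[n]}) :
  (forall v : 'rV_n, f1.@[fun i => v 0 i] = f2.@[fun i => v 0 i]) -> f1 = f2.
Proof.
move=> e; apply: mpoly_ext => v; have := e (\row_i v i).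
by rewrite !(meval_eq (v1 := fun i => (\row_i0 v i0) 0 i) (v2 := v)) // => i; rewrite mxE.
Qed.

Lemma act_poly_comp g h f : euclid h -> act_poly h (act_poly g f) = act_poly (g *m h) f.
Proof. by move=> eh; apply: mpoly_rV_ext => v; rewrite !act_polyE act_mul. Qed.

Lemma act_poly1 f : act_poly 1%:M f = f.
Proof. by apply: mpoly_rV_ext => v; rewrite act_polyE act1. Qed.

Lemma mdvd_act g f1 f2 : mdvd f1 f2 -> mdvd (act_poly g f1) (act_poly g f2).
Proof. by case=> D ->; exists (act_poly g D); rewrite rmorphM. Qed.

(** Composing with g^-1 turns a divisibility between two moved polynomials into one for k = h g^-1;
    this is how coinciding curves produce a symmetry. *)
Lemma mdvd_act_euclid g h f1 f2 : euclid g -> euclid h ->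
  mdvd (act_poly g f1) (act_poly h f2) -> exists2 k, euclid k /\ k *m g = h &
  mdvd f1 (act_poly k f2).
Proof.
move=> eg eh; have [g' [eg' gg' g'g]] := euclid_inv eg.
exists (h *m g'); first by split; [exact: euclid_mul | rewrite -mulmxA g'g mulmx1].
by have := mdvd_act g' H; rewrite !act_poly_comp // gg' act_poly1.
Qed.

Lemma mprime_act g f : euclid g -> mprime f -> mprime (act_poly g f).
Proof.
move=> eg pf A B; have [g' [eg' gg' g'g]] := euclid_inv eg.
have back X : act_poly g (act_poly g' X) = X by rewrite act_poly_comp // g'g act_poly1.
move=> /(mdvd_act g'); rewrite act_poly_comp // gg' act_poly1 rmorphM => /pf [] /(mdvd_act g).
  by rewrite back; left.
by rewrite back; right.
Qed.

Variable F : {mpoly K[2]}.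
Hypothesis F_irr : mirreducible F.
Hypothesis F_deg : (2 < msize F)%N.
Let C := zeros [set F].

Lemma F_neq0 : F != 0. Proof. by case: F_irr. Qed.

(** The Nullstellensatz for this curve: a polynomial not divisible by [F] has finitely many zeros on
    [C], which is infinite. *)
Lemma curve_ideal f : (forall v, C v -> f.@[fun i => v 0 i] = 0) -> mdvd F f.
Proof.
move=> fC; apply: contrapT => nd; apply: (curve_infinite F_irr F_deg).
apply: sub_finite_set (curve_inter_finite F_irr F_deg nd) => v Cv.
by split; [apply/curveP | apply: fC].
Qed.

Lemma mdvd_zero f v : mdvd F f -> C v -> f.@[fun i => v 0 i] = 0.
Proof. by case=> D -> Cv; rewrite mevalM (Cv F) // mul0r. Qed.

Lemma msize_act_gt1 g : euclid g -> (1 < msize (act_poly g F))%N.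
Proof.
move=> eg; have [g' [eg' gg' g'g]] := euclid_inv eg.
have FE : F = act_poly g' (act_poly g F) by rewrite act_poly_comp // gg' act_poly1.
rewrite ltnNge; apply/negP => /msize1_polyC e; move: F_deg.
by rewrite FE e /act_poly comp_mpolyC msizeC; case: (_ != _).
Qed.

Lemma curve_closed : zclosed C. Proof. by exists [set F]. Qed.

Lemma Sym_maps_to g v : Sym C g -> C v -> C (act g v).
Proof.
move=> [_ e] Cv; by rewrite e; apply: sub_gen_smallest; exists v.
Qed.

(** Inclusion of g C in C already forces equality: [F] divides F o g, and composing with g^-1 makes
    this a factorization of [F] itself, so the quotient is a nonzero constant. *)
Lemma Sym_of_maps_to g : euclid g -> (forall v, C v -> C (act g v)) -> Sym C g.
Proof.
move=> eg gC; have [g' [eg' gg' g'g]] := euclid_inv eg.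
have [D DE] : mdvd F (act_poly g F).
  by apply: curve_ideal => v /gC /curveP; rewrite act_polyE.
have FE : F = act_poly g' F * act_poly g' D.
  by rewrite -rmorphM -DE /= act_poly_comp // gg' act_poly1.
have uD : D \is a GRing.unit.
  case: F_irr => _ _ /(_ _ _ FE) [/msize_unit s1|uD].
    by have := msize_act_gt1 eg'; rewrite s1.
  by rewrite -[D]act_poly1 -g'g -act_poly_comp // rmorph_unit.
have k0 : D@_0%MM != 0.
  by apply/eqP => k0; move: (uD); rewrite (mpoly_unitE uD) k0 unitr0.
have gCE v : C (act g v) -> C v.
  move/curveP; rewrite -act_polyE DE mevalM (mpoly_unitE uD) mevalC => /eqP.
  by rewrite mulf_eq0 (negPf k0) orbF => /eqP/curveP.
have img : act g @` C = C.
  apply/seteqP; split=> [_ [v Cv <-]|w Cw]; first exact: gC.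
  exists (act g' w); last by rewrite -act_mul // gg' act1.
  by apply: gCE; rewrite -act_mul // gg' act1.
by split=> //; rewrite img /zclosure smallest_id //; exact: curve_closed.
Qed.

Lemma Sym_of_mdvd g : euclid g -> mdvd F (act_poly g F) -> Sym C g.
Proof.
move=> eg d; apply: Sym_of_maps_to => // v Cv.
by apply/curveP; rewrite -act_polyE; exact: mdvd_zero.
Qed.

Lemma Sym1 : Sym C 1%:M.
Proof. by apply: Sym_of_maps_to => [|v]; [exact: euclid1 | rewrite act1]. Qed.

(** For the inverse [h], F o h divides [F]; irreducibility makes the quotient a unit, so the
    divisibility can be reversed. *)
Lemma Sym_inv g : Sym C g -> exists2 h, Sym C h & h *m g = 1%:M.
Proof.
move=> Sg; have [eg gE] := Sg; have [h [eh gh hg]] := euclid_inv eg.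
exists h => //; apply: Sym_of_mdvd => //.
have [D DE] : mdvd (act_poly h F) F.
  rewrite -[X in mdvd _ X]act_poly1 -gh -act_poly_comp //; apply: mdvd_act.
  by apply: curve_ideal => v Cv; rewrite act_polyE; apply/curveP/Sym_maps_to.
have uD : D \is a GRing.unit.
  case: F_irr => _ _ /(_ _ _ DE) [/msize_unit s1|//].
  by have := msize_act_gt1 eh; rewrite s1.
by exists D^-1; rewrite {2}DE -mulrA mulrV // mulr1.
Qed.

Definition line_poly (a b c : K) : {mpoly K[2]} := a *: 'X_0 + b *: 'X_1 + c%:MP.

Lemma line_polyE a b c (v : 'I_2 -> K) : (line_poly a b c).@[v] = a * v 0 + b * v 1 + c.
Proof. by rewrite /line_poly !mevalD !mevalZ !mevalXU mevalC. Qed.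

Lemma msize_line a b c : (msize (line_poly a b c) <= 2)%N.
Proof.
rewrite /line_poly (leq_trans (msizeD_le _ _)) // geq_max msizeC.
rewrite (leq_trans (leq_b1 _)) // andbT (leq_trans (msizeD_le _ _)) //.
by rewrite geq_max !(leq_trans (msizeZ_le _ _)) // msizeX mdeg1.
Qed.

Lemma line_nonconst (a b c k : K) : (a != 0) || (b != 0) -> line_poly a b c <> k%:MP.
Proof.
move=> ab e; have ev (v : 'I_2 -> K) : a * v 0 + b * v 1 + c = k.
  by rewrite -line_polyE e mevalC.
have ck : c = k by rewrite -(ev (fun=> 0)) !mulr0 !add0r.
have a0 : a = 0.
  by apply: (addIr c); rewrite add0r [RHS]ck -(ev (fun i => (i == 0)%:R)) /= mulr0 mulr1 addr0.
have b0 : b = 0.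
  by apply: (addIr c); rewrite add0r [RHS]ck -(ev (fun i => (i == 1)%:R)) /= mulr0 mulr1 add0r.
by move: ab; rewrite a0 b0 eqxx.
Qed.

Lemma curve_not_line (a b c : K) : (a != 0) || (b != 0) -> ~ mdvd F (line_poly a b c).
Proof.
move=> ab; apply: (curve_not_in_line F_irr F_deg); last exact: msize_line.
by apply/eqP => e; apply: (@line_nonconst a b c 0 ab); rewrite e mpolyC0.
Qed.

Lemma line_not_dvd_curve (a b c : K) D : (a != 0) || (b != 0) -> F <> line_poly a b c * D.
Proof.
move=> ab; apply: (line_not_in_curve F_irr F_deg); first exact: msize_line.
by apply/negP => /mpoly_unitE; apply: line_nonconst.
Qed.

End Symmetries.

(** * Distances between points of a curve *)

Lemma mpolyX_dvd (R : comNzRingType) n (i : 'I_n) (p : {mpoly R[n]}) :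
  (forall m, m \in msupp p -> (0 < m i)%N) -> exists q, p = 'X_i * q.
Proof.
move=> pi; exists (\sum_(m <- msupp p) p@_m *: 'X_[m - U_(i)]).
rewrite {1}[p]mpolyE mulr_sumr; apply: eq_big_seq => m mp.
rewrite -scalerAr -mpolyXD; congr (_ *: 'X_[_]); apply/mnmP => j.
rewrite mnmDE mnmBE mnm1E; case: eqP => [<-|_]; last by rewrite add0n subn0.
by rewrite subnKC ?pi.
Qed.

Lemma meval_at0 (R : comNzRingType) n (p : {mpoly R[n]}) : p.@[fun=> 0] = p@_0%MM.
Proof.
apply: (@mpoly_rmorph_eq _ _ _ (meval (fun=> 0)) (mcoeff 0%MM)) => [c|i] /=.
  by rewrite mevalC mcoeffC eqxx mulr1.
by rewrite mevalXU mcoeffX mnm1_eq0.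
Qed.

Lemma nonzero_root (K : closedFieldType) (p : {poly K}) i j :
  i != j -> p`_i != 0 -> p`_j != 0 -> exists2 u, u != 0 & root p u.
Proof.
move=> ij pi pj; have p0 : p != 0 by apply: contra_neq pi => ->; rewrite coef0.
have [k [q]] := multiplicity_XsubC p 0; rewrite p0 subr0 /= => q0 pE.
have sq : size q != 1%N.
  apply/eqP => /eqP/size_poly1P[c c0 qE].
  have nz l : p`_l != 0 -> l = k.
    by rewrite pE qE coefCM coefXn; have [//|_] := eqVneq l k; rewrite mulr0 eqxx.
  by case/eqP: ij; rewrite (nz _ pi) (nz _ pj).
have /closed_rootP [u qu] := sq; exists u; first by apply: contraNneq q0 => <-.
by rewrite pE rootM qu.
Qed.

Section CurveGeometry.
Variables (K : numClosedFieldType) (F : {mpoly K[2]}).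
Hypothesis F_irr : mirreducible F.
Hypothesis F_deg : (2 < msize F)%N.
Let C := zeros [set F].
Implicit Types (g h : 'M[K]_3) (p q v w : 'rV[K]_2).

(** The squared distance to [p] is the product of the equations of the two isotropic lines through
    [p]. If it vanished on [C], the prime [F] would divide one of these linear forms. *)
Lemma curve_sqdist_neq0 p : exists2 v, C v & sqdist p v != 0.
Proof.
apply: contrapT => h.
pose l s := line_poly 1 (s * 'i) (- (p 0 0 + s * 'i * p 0 1)).
have : mdvd F (l 1 * l (-1)).
  apply: (curve_ideal F_irr F_deg) => v Cv.
  have <- : sqdist p v = 0 by apply/eqP/negPn/negP => nz; apply: h; exists v.
  rewrite mevalM !line_polyE /sqdist.
  transitivity ((p 0 0 - v 0 0) ^+ 2 - 'i ^+ 2 * (p 0 1 - v 0 1) ^+ 2); first by ring.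
  by rewrite sqrCi; ring.
by case/(mdvd_prime F_irr F_deg); apply: (curve_not_line F_irr F_deg); rewrite oner_eq0.
Qed.

Lemma curve_area_neq0 p q : sqdist p q != 0 -> exists2 v, C v & area p q v != 0.
Proof.
move=> D0; apply: contrapT => h.
apply: (@curve_not_line _ _ F_irr F_deg (- (q 0 1 - p 0 1)) (q 0 0 - p 0 0)
  ((q 0 1 - p 0 1) * p 0 0 - (q 0 0 - p 0 0) * p 0 1)).
  apply: contraR D0; rewrite negb_or !negbK oppr_eq0 !subr_eq0 => /andP[/eqP e1 /eqP e0].
  by rewrite /sqdist e0 e1; apply/eqP; ring.
apply: (curve_ideal F_irr F_deg) => v Cv.
have <- : area p q v = 0 by apply/eqP/negPn/negP => nz; apply: h; exists v.
by rewrite line_polyE /area; ring.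
Qed.

Lemma curve_triangle : exists p q v,
  [/\ C p, C q, C v, sqdist p q != 0 & area p q v != 0].
Proof.
have [p Cp] := infinite_setN0 (curve_infinite F_irr F_deg).
have [q Cq pq] := curve_sqdist_neq0 p; have [v Cv pqv] := curve_area_neq0 pq.
by exists p, q, v; split.
Qed.

(** A motion is determined by the images of three non-collinear points, so finite orbits for three
    such points of [C] would make [Sym C] finite. *)
Lemma infinite_orbit : infinite_set (Sym C) ->
  exists2 p, C p & infinite_set [set act g p | g in Sym C].
Proof.
move=> Sinf; have [p [q [v [Cp Cq Cv _ A0]]]] := curve_triangle.
apply: contrapT => h.
have fin w : C w -> finite_set [set act g w | g in Sym C].
  by move=> Cw; apply: contrapT => inf; apply: h; exists w.
pose f g := (act g p, (act g q, act g v)).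
have finj : {in Sym C &, injective f}.
  move=> g1 g2 /set_mem [e1 _] /set_mem [e2 _] [ep eq ev].
  exact: euclid_eq e1 e2 A0 ep eq ev.
apply: Sinf; rewrite -(eq_finite_set (inj_card_eq finj)).
apply: (@sub_finite_set _ _ ([set act g p | g in Sym C] `*`
    ([set act g q | g in Sym C] `*` [set act g v | g in Sym C]))).
  by move=> _ [g Sg <-]; split; [exists g | split; exists g].
by apply: finite_setX; [|apply: finite_setX]; apply: fin.
Qed.

Lemma distinct_orbits (n : nat) : finite_set (Sym C) -> exists p : nat -> 'rV[K]_2,
  (forall i, (i < n)%N -> C (p i)) /\
  (forall i j, (i < n)%N -> (j < n)%N -> i != j -> forall g, Sym C g -> act g (p i) <> p j).
Proof.
move=> Sfin; elim: n => [|n [p [Cp pij]]]; first by exists (fun=> 0).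
pose O := [set act gi.1 (p gi.2) | gi in Sym C `*` `I_n].
have Ofin : finite_set O by apply/finite_image/finite_setX.
have [v [Cv Ov]] : exists v, C v /\ ~ O v.
  apply: contrapT => h; apply: (curve_infinite F_irr F_deg).
  apply: sub_finite_set Ofin => v Cv.
  by apply: contrapT => nO; apply: h; exists v.
exists (fun i => if (i < n)%N then p i else v); split=> [i|i j].
  by rewrite ltnS; case: ltnP => // lt_in _; apply: Cp.
rewrite !ltnS => le_in le_jn ij g Sg.
case: ltnP => lt_in; case: ltnP => lt_jn.
- exact: pij.
- by move=> e; apply: Ov; exists (g, i).
- move=> e; apply: Ov; have [h Sh hg] := Sym_inv F_irr F_deg Sg.
  by exists (h, j) => //=; rewrite -e -act_mul ?hg ?act1 //; case: Sg.
by case/eqP: ij; apply/eqP; rewrite eqn_leq (leq_trans le_in) ?(leq_trans le_jn).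
Qed.

(* In the isotropic coordinates z = x + iy, w = x - iy centred at p, the circle of
   squared radius t is z w = t; on it F becomes a Laurent polynomial in z, with
   terms of both signs because C passes through p and contains no isotropic line. *)
Lemma cofinite_sqdist p : C p ->
  finite_set [set t | forall q, C q -> sqdist p q <> t].
Proof.
have frac (x y z s k : K) : x != 0 -> z * (k * (y * (s / x))) * x = k * s * (z * y).
  by move=> x0; field.
move=> Cp; pose j := ('i : K).
have j2 : j * j = -1 by rewrite -expr2 sqrCi.
have j0 : j != 0 by rewrite neq0Ci.
have two0 : 2%:R != 0 :> K by rewrite pnatr_eq0.
(* [G] is [F] in the isotropic coordinates: the displacement from p is ((z + w) / 2, (z - w) /
   (2i)). *)
pose G := F \mPo [tuple of [:: line_poly 2%:R^-1 2%:R^-1 (p 0 0);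
                          line_poly (2%:R * j)^-1 (- (2%:R * j)^-1) (p 0 1)]].
have GE (z w : K) : G.@[fun i : 'I_2 => if i == 0 then z else w] =
    F.@[fun i : 'I_2 => if i == 0 then p 0 0 + (z + w) / 2%:R
                        else p 0 1 + (z - w) / (2%:R * j)].
  rewrite /G comp_mpoly_meval; apply: meval_eq => i.
  by case: (ord2P i) => -> /=; rewrite (tnth_nth 0) /= line_polyE /=; field; rewrite ?j0.
pose Linv := [tuple of [:: line_poly 1 j (- (p 0 0 + j * p 0 1));
                           line_poly 1 (- j) (- (p 0 0 - j * p 0 1))]].
have FE : F = G \mPo Linv.
  apply: mpoly_ext => v.
  rewrite comp_mpoly_meval.
  rewrite [RHS](@meval_eq _ _ _ (fun i : 'I_2 =>
      if i == 0 then v 0 + j * v 1 - (p 0 0 + j * p 0 1)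
      else v 0 - j * v 1 - (p 0 0 - j * p 0 1))); last first.
    by move=> i; case: (ord2P i) => ->; rewrite (tnth_nth 0) /= line_polyE; ring.
  rewrite GE; apply: meval_eq => i.
  by case: (ord2P i) => -> /=; field; rewrite ?j0.
have G00 : G@_0%MM = 0.
  have := GE 0 0; rewrite (_ : F.@[_] = 0); last first.
    have /curveP Fp := Cp; rewrite -[RHS]Fp; apply: meval_eq => i.
    by case: (ord2P i) => -> /=; rewrite ?addr0 ?subrr ?mul0r ?addr0.
  rewrite -meval_at0 => e; rewrite -[RHS]e; apply: meval_eq => i.
  by case: ifP.
have nX (l : {mpoly K[2]}) i a b c : (a != 0) || (b != 0) ->
    'X_i \mPo Linv = line_poly a b c -> exists2 m, m \in msupp G & m i = 0%N.
  move=> ab lE; apply: contrapT => h.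
  have [m mG|D DE] := @mpolyX_dvd _ _ i G.
    by rewrite lt0n; apply/eqP => mi; apply: h; exists m.
  apply: (@line_not_dvd_curve _ _ F_irr F_deg a b c (D \mPo Linv) ab).
  by rewrite -lE -rmorphM -DE.
(* If every monomial of [G] contained z, an isotropic line through [p] would divide [F]. So [mA] is
   free of z, and likewise [mB] is free of w; neither is constant because G(0, 0) = 0. *)
have [mA mAG mA0] : exists2 m, m \in msupp G & m 0 = 0%N.
  apply: (nX 0 _ 1 j (- (p 0 0 + j * p 0 1))); first by rewrite oner_eq0.
  by rewrite comp_mpolyXU.
have [mB mBG mB1] : exists2 m, m \in msupp G & m 1 = 0%N.
  apply: (nX 0 _ 1 (- j) (- (p 0 0 - j * p 0 1))); first by rewrite oner_eq0.
  by rewrite comp_mpolyXU.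
have supp_pos m i : m \in msupp G -> m i = 0%N -> exists k, (0 < m k)%N /\ k != i.
  move=> mG mi; apply: contrapT => h; move: mG; rewrite mcoeff_msupp.
  suff -> : m = 0%MM by rewrite G00 eqxx.
  apply/mnmP => k; rewrite mnm0E; apply/eqP; rewrite -leqn0 leqNgt; apply/negP => mk.
  by apply: h; exists k; split=> //; apply/eqP => ki; rewrite ki mi in mk.
have mA1 : (0 < mA 1%R)%N.
  by have [k []] := supp_pos _ _ mAG mA0; case: (ord2P k) => ->.
have mB0 : (0 < mB 0%R)%N.
  by have [k []] := supp_pos _ _ mBG mB1; case: (ord2P k) => ->.
pose N := msize G.
have supp_le m i : m \in msupp G -> (m i <= N)%N.
  move=> mG; apply: leq_trans (ltnW (msize_mdeg_lt mG)).
  by rewrite mdegE (bigD1 i) //= leq_addr.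
(* The exponent of z in z^N G(z, t / z); the shift by [N] avoids negative exponents, so the
   subtraction is not truncated on the support. [c e] is the coefficient of z^e there, as a
   polynomial in t. *)
pose deg (m : 'X_{1..2}) := (N + m 0%R - m 1%R)%N.
pose c e : {poly K} := \sum_(m <- msupp G | deg m == e) G@_m *: 'X^(m 1%R).
have c0 m i : m \in msupp G -> m i = 0%N -> c (deg m) != 0.
  move=> mG mi; apply/eqP => /(congr1 (coefp (m 1%R))) /=.
  rewrite coef0 /c big_mkcond coef_sum (bigD1_seq m) ?msupp_uniq //= eqxx coefZ coefXn.
  rewrite eqxx mulr1 big1 ?addr0 => [/eqP|m' mm'].
    by rewrite mcoeff_eq0 mG.
  have [dm|_] := eqVneq (deg m') (deg m); last by rewrite coef0.
  rewrite coefZ coefXn; case: eqP => [e|]; last by rewrite mulr0.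
  case/eqP: mm'; apply/mnmP => k; move: dm; rewrite /deg -e => dm.
  have := supp_le _ 1 mG; rewrite e => leN.
  by case: (ord2P k) => -> //; lia.
(* For other values of t both terms survive, of degrees below and above [N]; a nonzero root [u] then
   gives the point of [C] with z = u and w = t / u. *)
apply: (@sub_finite_set _ _ ([set t | root (c (deg mA)) t] `|` [set t | root (c (deg mB)) t])).
  move=> t tC; apply: contrapT => /not_orP [rA rB].
  pose P : {poly K} := \sum_(m <- msupp G) (G@_m * t ^+ m 1%R) *: 'X^(deg m).
  have PE m : ~ root (c (deg m)) t -> P`_(deg m) != 0.
    move/negP; apply: contra => /eqP P0; apply/rootP; rewrite -[RHS]P0.
    rewrite /c /P horner_sum coef_sum big_mkcond /=; apply: eq_bigr => m' _.
    rewrite coefZ coefXn hornerZ hornerXn eq_sym.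
    by case: eqP; rewrite ?mulr1 ?mulr0.
  have AB : deg mA != deg mB.
    have := supp_le _ 1 mAG; rewrite /deg mA0 mB1 => ?; apply/eqP; lia.
  have [u u0 Pu] := nonzero_root AB (PE _ rA) (PE _ rB).
  have Gu : G.@[fun i : 'I_2 => if i == 0 then u else t / u] = 0.
    apply: (mulfI (expf_neq0 N u0)); rewrite mulr0 -[RHS](rootP Pu) /P horner_sum.
    rewrite mevalE mulr_sumr; apply: eq_big_seq => m mG.
    rewrite hornerZ hornerXn big_ord_recl big_ord1 /= expr_div_n.
    rewrite (_ : lift _ _ = 1); last exact: val_inj.
    have mu : u ^+ m 1%R != 0 by rewrite expf_neq0.
    apply: (mulIf mu); rewrite -[RHS]mulrA -exprD subnK; last first.
      by rewrite (leq_trans (supp_le _ 1 mG)) // leq_addr.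
    by rewrite exprD; apply: frac.
  apply: (tC (\row_i if i == 0 then p 0 0 + (u + t / u) / 2%:R
                      else p 0 1 + (u - t / u) / (2%:R * j))).
    apply/curveP; rewrite -[RHS]Gu GE; apply: meval_eq => i.
    by rewrite mxE.
  rewrite /sqdist !mxE /=.
  have tE : t = u * (t / u) by field.
  move: (t / u) tE => w ->.
  transitivity ((u + w) ^+ 2 / 4%:R + (u - w) ^+ 2 / (4%:R * (j * j))).
    by field; rewrite j0.
  by rewrite j2; field.
have fr m i : m \in msupp G -> m i = 0%N -> finite_set [set t | root (c (deg m)) t].
  move=> mG mi; have [s sP] := poly_roots_seq (c0 _ _ mG mi).
  by apply: sub_finite_set (finite_seq s) => t; apply: sP.
by rewrite finite_setU; split; [apply: fr mAG mA0 | apply: fr mBG mB1].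
Qed.

Lemma infinite_sqdist p : C p -> infinite_set [set sqdist p q | q in C].
Proof.
move=> Cp fin; apply: (@numDomain_infinite K).
apply: (@sub_finite_set _ _ ([set sqdist p q | q in C] `|`
   [set t | forall q, C q -> sqdist p q <> t])); last first.
  by rewrite finite_setU; split=> //; apply: cofinite_sqdist.
move=> t _; have [[q Cq qt]|h] := pselect (exists2 q, C q & sqdist p q = t).
  by left; exists q.
by right => q Cq qt; apply: h; exists q.
Qed.

End CurveGeometry.

(** * Zariski closures and separating polynomials *)

Section Closure.
Variables (K : fieldType) (m : nat).
Implicit Types (A : set 'rV[K]_m) (f : {mpoly K[m]}).

Lemma zclosure_vanish A f : (forall v, A v -> f.@[fun i => v 0 i] = 0) ->
  forall v, zclosure A v -> f.@[fun i => v 0 i] = 0.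
Proof.
move=> fA; suff sub : zclosure A `<=` zeros [set f] by move=> v /sub; apply.
by apply: smallest_sub => [|v Av _ ->]; [exists [set f] | apply: fA].
Qed.

Lemma zclosureP A v : ~ zclosure A v ->
  exists2 f, (forall w, A w -> f.@[fun i => w 0 i] = 0) & f.@[fun i => v 0 i] != 0.
Proof.
move=> nv; apply: contrapT => h; apply: nv => B [[S ->] AS] f Sf.
apply: contrapT => /eqP fv; apply: h; exists f => // w Aw.
exact: AS.
Qed.

Lemma zclosed_zclosure A : zclosed (zclosure A).
Proof.
exists [set f | forall w, A w -> f.@[fun i => w 0 i] = 0].
apply/seteqP; split=> [v Av f fA|v fv]; first exact: zclosure_vanish fA v Av.
apply: contrapT => /zclosureP [f fA]; rewrite fv ?eqxx //.
Qed.
End Closure.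

Lemma zdense_vanish (K : numClosedFieldType) m (A : set 'rV[K]_m) f : zdense A ->
  polyfun (@rowcoord K m) f -> (forall v, A v -> f v = 0) -> forall v, f v = 0.
Proof.
move=> Ad [h hE] fA v; rewrite hE; apply: (@zclosure_vanish _ _ A).
  by move=> w /fA; rewrite hE.
by rewrite Ad.
Qed.

(** * The maps d_n, and curves with infinitely many symmetries *)

Section Distances.
Variables (K : numClosedFieldType).
Implicit Types (g h : 'M[K]_3).

(** The order of the coordinates of [dmap] stays implicit: this lemma finds the coordinate of a
    pair, and [dmap_entry] the pair of a coordinate. *)
Lemma dmap_index n (j k : 'I_n) : (j < k)%N ->
  exists e, forall P : 'M[K]_(n, 2), dmap P 0 e = sqdist (row j P) (row k P).
Proof.
move=> jk; have jkP : (j, k) \in @pairs n by rewrite inE.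
exists (cast_ord (card_pairs n) (enum_rank_in jkP (j, k))) => P.
by rewrite mxE cast_ordK enum_rankK_in.
Qed.

Lemma dmap_entry n (e : 'I_('C(n, 2))) : exists j k : 'I_n, (j < k)%N /\
  forall P : 'M[K]_(n, 2), dmap P 0 e = sqdist (row j P) (row k P).
Proof.
have := enum_valP (cast_ord (esym (card_pairs n)) e) => jk.
by do 2 eexists; split; [exact: jk | move=> P; rewrite mxE].
Qed.

Lemma dmap_eq n (P Q : 'M[K]_(n, 2)) : dmap P = dmap Q <->
  forall j k, sqdist (row j P) (row k P) = sqdist (row j Q) (row k Q).
Proof.
split=> [PQ j k|PQ]; last by apply/rowP => e; have [j [k [_ de]]] := dmap_entry e; rewrite !de.
have lt_case (i l : 'I_n) : (i < l)%N ->
    sqdist (row i P) (row l P) = sqdist (row i Q) (row l Q).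
  by move=> /dmap_index [e de]; rewrite -!de PQ.
have [/lt_case //|/lt_case|/val_inj->] := ltngtP j k.
  by rewrite sqdistC [RHS]sqdistC.
by rewrite /sqdist !subrr.
Qed.

Lemma polyfun_sqdist (T : Type) N (coord : 'I_N -> T -> K) (p q : T -> 'rV[K]_2) :
  (forall i, polyfun coord (fun t => p t 0 i)) ->
  (forall i, polyfun coord (fun t => q t 0 i)) ->
  polyfun coord (fun t => sqdist (p t) (q t)).
Proof.
by move=> pp pq; apply: polyfunD; apply: polyfunX; apply: polyfunB.
Qed.

Lemma polyfun_area (T : Type) N (coord : 'I_N -> T -> K) (p q r : T -> 'rV[K]_2) :
  (forall i, polyfun coord (fun t => p t 0 i)) ->
  (forall i, polyfun coord (fun t => q t 0 i)) ->
  (forall i, polyfun coord (fun t => r t 0 i)) ->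
  polyfun coord (fun t => area (p t) (q t) (r t)).
Proof.
by move=> pp pq pr; apply: polyfunB; apply: polyfunM; apply: polyfunB.
Qed.

Lemma polyfun_row n (j : 'I_n) i : polyfun (@mxcoord K n) (fun P => row j P 0 i).
Proof. by apply: polyfun_eq (polyfun_mxentry K j i) => P; rewrite mxE. Qed.

Lemma polyfun_dmap n (e : 'I_('C(n, 2))) : polyfun (@mxcoord K n) (fun P => dmap P 0 e).
Proof.
have [j [k [_ de]]] := dmap_entry e.
apply: (@polyfun_eq _ _ _ _ (fun P => sqdist (row j P) (row k P))) => [P|].
  by rewrite de.
by apply: polyfun_sqdist => i; apply: polyfun_row.
Qed.

Definition actrows n g (P : 'M[K]_(n, 2)) : 'M[K]_(n, 2) :=
  \matrix_(i, j) act g (row i P) 0 j.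

Lemma row_actrows n g (P : 'M[K]_(n, 2)) i : row i (actrows g P) = act g (row i P).
Proof. by apply/rowP => j; rewrite !mxE. Qed.

Lemma dmap_actrows n g (P : 'M[K]_(n, 2)) : euclid g -> dmap (actrows g P) = dmap P.
Proof. by move=> eg; apply/dmap_eq => j k; rewrite !row_actrows sqdist_act. Qed.

Definition addrow n (a : 'rV[K]_2) (P : 'M[K]_(n, 2)) : 'M[K]_(n.+1, 2) :=
  \matrix_(i, j) if unlift ord_max i is Some k then P k j else a 0 j.

Lemma row_addrow_max n a (P : 'M[K]_(n, 2)) : row ord_max (addrow a P) = a.
Proof. by apply/rowP => j; rewrite !mxE unlift_none. Qed.

Lemma row_addrow_lift n a (P : 'M[K]_(n, 2)) k :
  row (lift ord_max k) (addrow a P) = row k P.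
Proof. by apply/rowP => j; rewrite !mxE liftK. Qed.

Lemma addrow_row' n (P : 'M[K]_(n.+1, 2)) : addrow (row ord_max P) (row' ord_max P) = P.
Proof.
apply/row_matrixP => i; case: (unliftP ord_max i) => [k ->|->].
  by rewrite row_addrow_lift; apply/rowP => j; rewrite !mxE.
by rewrite row_addrow_max.
Qed.

Lemma polyfun_addrow n a i j : polyfun (@mxcoord K n) (fun P => addrow a P i j).
Proof.
case: (unliftP ord_max i) => [k ->|->].
  by apply: polyfun_eq (polyfun_mxentry K k j) => P; rewrite mxE liftK.
by apply: polyfun_eq (polyfun_cst _ (a 0 j)) => P; rewrite mxE unlift_none.
Qed.

Variable F : {mpoly K[2]}.
Hypothesis F_irr : mirreducible F.
Hypothesis F_deg : (2 < msize F)%N.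
Let C := zeros [set F].

Lemma cpow_addrow n (P : 'M[K]_(n, 2)) a : cpow C n P -> C a -> cpow C n.+1 (addrow a P).
Proof.
move=> CP Ca i; case: (unliftP ord_max i) => [k ->|->].
  by rewrite row_addrow_lift.
by rewrite row_addrow_max.
Qed.

Lemma cpow_actrows n (P : 'M[K]_(n, 2)) g : cpow C n P -> Sym C g -> cpow C n (actrows g P).
Proof. by move=> CP Sg i; rewrite row_actrows; exact: Sym_maps_to Sg (CP i). Qed.

(** A last point g a, with [g] a symmetry, is brought back to [a] by the inverse symmetry without
    changing distances, so [f] vanishes. With the other points fixed, this is a polynomial function
    of the last point vanishing on an infinite subset of [C]. *)
Lemma orbit_vanish a n f : C a -> infinite_set [set act g a | g in Sym C] ->
  polyfun (@rowcoord K 'C(n.+1, 2)) f ->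
  (forall P, cpow C n P -> f (dmap (addrow a P)) = 0) ->
  forall P, cpow C n.+1 P -> f (dmap P) = 0.
Proof.
move=> Ca Oinf pf f0 P CP.
have pfs : polyfun (@rowcoord K 2) (fun v => f (dmap (setrow P ord_max v))).
  apply: (@polyfun_mxcomp _ _ _ _ _ (setrow P ord_max) (fun Q => f (dmap Q))).
    by move=> i j; apply: polyfun_setrow.
  by apply: polyfun_rowcomp pf => e; apply: polyfun_dmap.
rewrite -(setrow_id P ord_max).
apply: (curve_vanish F_irr F_deg pfs Oinf); last exact: CP.
  by move=> _ [g Sg <-]; exact: Sym_maps_to Sg Ca.
move=> _ [g Sg <-]; have [h Sh hg] := Sym_inv F_irr F_deg Sg.
set Q := setrow _ _ _; have CQ : cpow C n.+1 Q.
  by apply: cpow_setrow => //; exact: Sym_maps_to Sg Ca.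
rewrite -(dmap_actrows Q (proj1 Sh)) -(addrow_row' (actrows h Q)).
rewrite row_actrows row_setrow eqxx -act_mul ?hg ?act1; last by case: Sg.
apply: f0 => i; have := cpow_actrows CQ Sh (lift ord_max i).
congr (C _); apply/rowP => j; by rewrite !mxE.
Qed.

Lemma infinite_Sym_dependent n (f : 'I_n.+1 -> 'rV[K]_('C(n.+1, 2)) -> K) :
  infinite_set (Sym C) -> (forall i, polyfun (@rowcoord K _) (f i)) ->
  exists Q : {mpoly K[n.+1]}, Q != 0 /\
    forall P, cpow C n.+1 P -> Q.@[fun i => f i (dmap P)] = 0.
Proof.
move=> /(infinite_orbit F_irr F_deg) [a Ca Oinf] pf.
have [|Q [Q0 QE]] := @curve_power_dependent _ _ (F_neq0 F_irr) n
    (fun i P => f i (dmap (addrow a P))).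
  move=> i; apply: (@polyfun_rowcomp _ _ _ _ _ (fun P => dmap (addrow a P))) (pf i) => e.
  apply: (@polyfun_mxcomp _ _ _ _ _ (addrow a) (fun P => dmap P 0 e)).
    by move=> k j; apply: polyfun_addrow.
  exact: polyfun_dmap.
exists Q; split=> //.
apply: (@orbit_vanish a n (fun d => Q.@[fun i => f i d]) Ca Oinf) => //.
exact: polyfun_meval.
Qed.

Lemma infinite_Sym_not_dense : infinite_set (Sym C) ->
  ~ zdense (@dmap _ 3 @` cpow C 3 : set 'rV[K]_3).
Proof.
move=> Sinf D.
have [|Q [Q0 QE]] := @infinite_Sym_dependent 2 (fun i v => v 0 i) Sinf.
  by move=> i; exact: (polyfun_coord (@rowcoord K 'C(3, 2)) i).
have [v _] := mpoly_nonroot (@numDomain_infinite K) Q0.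
have pQ : polyfun (@rowcoord K 3) (fun w => Q.@[fun i => w 0 i]) by exists Q.
have := @zdense_vanish _ _ _ _ D pQ _ (\row_i v i).
rewrite (meval_eq (v2 := v)) => [->|i]; rewrite ?mxE ?eqxx //.
by move=> _ [P CP <-]; apply: QE.
Qed.

End Distances.

(** * Dominance of d_3 *)

Lemma mmap_polyC_horner (R : comNzRingType) n (h : 'I_n -> {poly R}) (p : {mpoly R[n]}) x :
  (mmap polyC h p).[x] = p.@[fun i => (h i).[x]].
Proof.
apply: (@mpoly_rmorph_eq _ _ _ (horner_eval x \o mmap polyC h)
  (meval (fun i => (h i).[x]))) => [c|i] /=.
  by rewrite mmapC /horner_eval hornerC mevalC.
by rewrite mmapX mmap1U mevalXU.
Qed.

Lemma msize_comp_bound (R : idomainType) n k (p : {mpoly R[n]})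
    (lq : n.-tuple {mpoly R[k]}) a : (forall i, (msize (tnth lq i) <= a.+1)%N) ->
  (msize (p \mPo lq) <= (n * (msize p * a)).+1)%N.
Proof.
move=> qa; rewrite comp_mpolyEX big_seq; elim/big_rec: _ => [|m q mp IH]; first by rewrite msize0.
rewrite (leq_trans (msizeD_le _ _)) // geq_max IH andbT (leq_trans (msizeZ_le _ _)) //.
rewrite comp_mpolyX; have := @msize_prod_bound _ _ _ (index_enum 'I_n)
  (fun i => tnth lq i ^+ m i) (msize p * a)%N.
rewrite /index_enum -enumT size_enum_ord; apply => i.
rewrite (leq_trans (msizeX_bound _ (qa i))) // ltnS leq_mul2r.
apply/orP; right; apply: leq_trans (ltnW (msize_mdeg_lt mp)).
by rewrite mdegE (bigD1 i) //= leq_addr.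
Qed.

Section Triples.
Variables (K : numClosedFieldType).
Implicit Types (p q r : 'rV[K]_2).

Definition tri p q r : 'M[K]_(3, 2) :=
  \matrix_(i, j) (if i == 0 then p else if i == 1 then q else r) 0 j.

Lemma row_tri p q r : [/\ row 0 (tri p q r) = p, row 1 (tri p q r) = q &
  row 2%:R (tri p q r) = r].
Proof. by split; apply/rowP => j; rewrite !mxE. Qed.

Let jk (e : 'I_('C(3, 2))) := enum_val (cast_ord (esym (card_pairs 3)) e).

Lemma jk_cases e : [\/ jk e = (0, 1), jk e = (0, 2%:R) | jk e = (1, 2%:R)].
Proof.
have : (jk e \in @pairs 3) by apply: enum_valP.
case: (jk e) => j k; rewrite [_ \in _]/((j < k)%N : bool).
case: (ord3P j) => ->; case: (ord3P k) => -> //= _;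
  by [apply: Or31 | apply: Or32 | apply: Or33].
Qed.

Lemma jk_inj : injective jk.
Proof. by move=> e e' /enum_val_inj /cast_ord_inj. Qed.

(* The point of K^3 with d_12 = a, d_13 = b, d_23 = c. *)
Definition vec3 (a b c : K) : 'rV[K]_('C(3, 2)) :=
  \row_e if (jk e).1 == 0 then if (jk e).2 == 1 then a else b else c.

Lemma dmap_tri p q r : dmap (tri p q r) = vec3 (sqdist p q) (sqdist p r) (sqdist q r).
Proof.
apply/rowP => e; rewrite !mxE -/(jk e); have [r0 r1 r2] := row_tri p q r.
by case: (jk_cases e) => -> /=; rewrite ?r0 ?r1 ?r2.
Qed.

(** Valid for any order of the coordinates, since [jk] is injective; 0 is the default for a pair
    that no coordinate would carry. *)
Lemma vec3_surj v : exists a b c, v = vec3 a b c.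
Proof.
have ex x : exists a, forall e, jk e = x -> v 0 e = a.
  have [[e je]|h] := pselect (exists e, jk e = x).
    by exists (v 0 e) => e' je'; rewrite (jk_inj (etrans je' (esym je))).
  by exists 0 => e je; case: h; exists e.
have [a aE] := ex (0, 1); have [b bE] := ex (0, 2%:R); have [c cE] := ex (1, 2%:R).
exists a, b, c; apply/rowP => e; rewrite mxE.
by case: (jk_cases e) => je; rewrite je /= ?(aE _ je) ?(bE _ je) ?(cE _ je).
Qed.

Lemma cpow_tri (C : set 'rV[K]_2) p q r : C p -> C q -> C r -> cpow C 3 (tri p q r).
Proof.
move=> Cp Cq Cr i; have [r0 r1 r2] := row_tri p q r.
by case: (ord3P i) => ->; rewrite ?r0 ?r1 ?r2.
Qed.

Lemma tri_row (P : 'M[K]_(3, 2)) : P = tri (row 0 P) (row 1 P) (row 2%:R P).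
Proof.
have [r0 r1 r2] := row_tri (row 0 P) (row 1 P) (row 2%:R P).
by apply/row_matrixP => i; case: (ord3P i) => ->; rewrite ?r0 ?r1 ?r2.
Qed.

(** The point is p + s (q - p) + t J(q - p), with J the quarter turn. Subtracting the two equations
    gives [s]; then [t] is a square root, which exists in [K]. *)
Lemma two_circles p q b c : sqdist p q != 0 ->
  exists r, sqdist p r = b /\ sqdist q r = c.
Proof.
set D := sqdist p q => D0; pose s := ((b - c) / D + 1) / 2%:R.
have two0 : 2%:R != 0 :> K by rewrite pnatr_eq0.
pose t := sqrtC (b / D - s ^+ 2).
have sD : 2%:R * s * D = b - c + D by rewrite /s; field; rewrite D0.
have tD : t ^+ 2 * D = b - s ^+ 2 * D by rewrite sqrtCK mulrBl divfK.
clearbody s t.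
pose x := q 0 0 - p 0 0; pose y := q 0 1 - p 0 1.
have DE : D = x ^+ 2 + y ^+ 2 by rewrite /D sqdistC.
exists (\row_i if i == 0 then p 0 0 + s * x - t * y else p 0 1 + s * y + t * x).
rewrite /sqdist !mxE /=; split.
  transitivity (s ^+ 2 * (x ^+ 2 + y ^+ 2) + t ^+ 2 * (x ^+ 2 + y ^+ 2)); first by ring.
  by rewrite -DE tD; ring.
transitivity (s ^+ 2 * (x ^+ 2 + y ^+ 2) + t ^+ 2 * (x ^+ 2 + y ^+ 2) -
  2%:R * s * (x ^+ 2 + y ^+ 2) + (x ^+ 2 + y ^+ 2)); first by rewrite /x /y; ring.
by rewrite -DE tD sD; ring.
Qed.

Definition sqdist_poly p : {mpoly K[2]} := ('X_0 - (p 0 0)%:MP) ^+ 2 + ('X_1 - (p 0 1)%:MP) ^+ 2.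

Lemma sqdist_polyE p r : (sqdist_poly p).@[fun i => r 0 i] = sqdist p r.
Proof.
by rewrite mevalD !rmorphXn /= !mevalB !mevalXU !mevalC sqdistC.
Qed.

Lemma msize_sqdist_poly p : (msize (sqdist_poly p) <= 3)%N.
Proof.
rewrite (leq_trans (msizeD_le _ _)) // geq_max; apply/andP; split;
  apply: (leq_trans (msizeX_bound (a := 1) 2 _)) => //;
  by rewrite (leq_trans (msizeD_le _ _)) // geq_max msizeN msizeX mdeg1 msizeC
    (leq_trans (leq_b1 _)).
Qed.

Variable f : {mpoly K['C(3, 2)]}.

(* The locus of third vertices when the first two are p and q, at distance t. *)
Definition third_vertex (t : K) p q : {mpoly K[2]} :=
  f \mPo [tuple if (jk e).1 == 0 then if (jk e).2 == 1 then t%:MP else sqdist_poly p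
                else sqdist_poly q | e < 'C(3, 2)].

Lemma third_vertexE t p q r : (third_vertex t p q).@[fun i => r 0 i] =
  f.@[fun e => vec3 t (sqdist p r) (sqdist q r) 0 e].
Proof.
rewrite comp_mpoly_meval; apply: meval_eq => e; rewrite tnth_mktuple mxE.
by case: ifP => _; [case: ifP => _|]; rewrite ?mevalC ?sqdist_polyE.
Qed.

(** Squared distances have degree 2, whence the factor 2. The bound is uniform in [t], [p] and [q],
    so the number of segments can be fixed before they are chosen. *)
Lemma msize_third_vertex t p q :
  (msize (third_vertex t p q) <= ('C(3, 2) * (msize f * 2)).+1)%N.
Proof.
apply: msize_comp_bound => e; rewrite tnth_mktuple.
case: ifP => _; [case: ifP => _|]; rewrite ?msize_sqdist_poly //.
by rewrite msizeC (leq_trans (leq_b1 _)).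
Qed.

End Triples.

Section Density.
Variables (K : numClosedFieldType) (F : {mpoly K[2]}).
Hypothesis F_irr : mirreducible F.
Hypothesis F_deg : (2 < msize F)%N.
Let C := zeros [set F].

Lemma finite_Sym_dense : finite_set (Sym C) ->
  zdense (@dmap _ 3 @` cpow C 3 : set 'rV[K]_3).
Proof.
move=> Sfin; apply: contrapT => nd.
have [v nv] : exists v : 'rV[K]_3, ~ zclosure (@dmap _ 3 @` cpow C 3) v.
  apply: contrapT => h; apply: nd; apply/seteqP; split=> // v _.
  by apply: contrapT => nv; apply: h; exists v.
have [f fC fv] := zclosureP nv.
have [a [b [c vE]]] := vec3_surj v.
have fT p q r : C p -> C q -> C r ->
    f.@[fun e => vec3 (sqdist p q) (sqdist p r) (sqdist q r) 0 e] = 0.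
  move=> Cp Cq Cr; rewrite -dmap_tri; apply: fC.
  by exists (tri p q r) => //; apply: cpow_tri.
(* The relation on the line of triples (t, b, c). It is nonzero because its value at t = a is that
   of [f] at [v], a point outside the closure. *)
pose u := mmap polyC (fun e => if (enum_val (cast_ord (esym (card_pairs 3)) e)).1 == 0
  then if (enum_val (cast_ord (esym (card_pairs 3)) e)).2 == 1 then 'X else b%:P
  else c%:P) f.
have uE t : u.[t] = f.@[fun e => vec3 t b c 0 e].
  rewrite mmap_polyC_horner; apply: meval_eq => e; rewrite mxE.
  by case: ifP => _; [case: ifP => _|]; rewrite ?hornerX ?hornerC.
have u0 : u != 0 by apply: contra_neq fv => u0; rewrite vE -uE u0 horner0.
pose B := ('C(3, 2) * (msize f * 2)).+1.
have [p [Cp pij]] := distinct_orbits F_irr F_deg B.+1 Sfin.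
pose bad i := [set t | forall q, C q -> sqdist (p i) q <> t].
(* Three finite sets are avoided: the roots of [u], to keep the third-vertex locus a curve; 0, so
   that motions can be built from the segments; and the values not attained as squared distances
   from some [p i]. *)
have [t tbad] : exists t, ~ ([set t | root u t] `|` ([set 0] `|` \bigcup_(i in `I_B.+1) bad i)) t.
  apply: contrapT => h; apply: (@numDomain_infinite K).
  apply: (@sub_finite_set _ _
    ([set t | root u t] `|` ([set 0] `|` \bigcup_(i in `I_B.+1) bad i))).
    by move=> t _; apply: contrapT => nt; apply: h; exists t.
  rewrite finite_setU; split.
    have [s sP] := poly_roots_seq u0.
    by apply: sub_finite_set (finite_seq s) => t; apply: sP.
  rewrite finite_setU; split=> //.
  apply: bigcup_finite => // i ltiB; apply: (cofinite_sqdist F_irr F_deg).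
  exact: Cp.
have ut : u.[t] != 0 by apply/negP => ut; apply: tbad; left.
have t0 : t != 0 by apply/eqP => t0; apply: tbad; right; left.
have /choice [q qP] : forall i, exists q, (i < B.+1)%N -> C q /\ sqdist (p i) q = t.
  move=> i; have [iB|_] := ltnP i B.+1; last by exists 0.
  apply: contrapT => h; apply: tbad; right; right; exists i => // q Cq qt.
  by apply: h; exists q.
have [C0 d0] := qP 0%N isT.
have /choice [g gP] : forall i, exists g, (i < B.+1)%N ->
    [/\ euclid g, act g (p 0%N) = p i & act g (q 0%N) = q i].
  move=> i; have [iB|_] := ltnP i B.+1; last by exists 0.
  have [_ di] := qP i iB.
  have e1 : sqdist (p 0%N) (q 0%N) = sqdist (p i) (q i) by rewrite d0 di.
  have e2 : sqdist (p 0%N) (q 0%N) != 0 by rewrite d0.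
  have [g [eg gp gq _]] := euclid_of_segment (or_intror (erefl 1)) e1 e2.
  by exists g.
pose H := third_vertex f t (p 0%N) (q 0%N).
(* At a point of the plane with squared distances [b] and [c] from the two ends, [H] takes the value
   u(t). *)
have H0 : H != 0.
  have [|r [rb rc]] := @two_circles _ (p 0%N) (q 0%N) b c; first by rewrite d0.
  by apply: contra_neq ut => H0; rewrite uE -rb -rc -third_vertexE -/H H0 meval0.
suff : (B.+1 < msize H)%N.
  by rewrite ltnNge leqW // /H /B msize_third_vertex.
apply: (@prime_factors_lt_msize _ _ (fun i : 'I_B.+1 => act_poly (g i) F)) => // [i|i j ij].
  have [eg gp gq] := gP i (ltn_ord i); have [Ci di] := qP i (ltn_ord i); split.
  - by apply: mprime_act => // A D; apply: mdvd_prime.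
  - exact: msize_act_gt1.
  (* The locus of the i-th segment, pulled back by [g i], is that of the segment number 0; and the
     locus of the i-th segment contains [C] by the relation [fT]. *)
  have -> : H = act_poly (g i) (third_vertex f t (p i) (q i)).
    apply: mpoly_rV_ext => r; rewrite act_polyE !third_vertexE.
    by rewrite -gp -gq !sqdist_act.
  apply: mdvd_act; apply: (curve_ideal F_irr F_deg) => r Cr.
  by rewrite third_vertexE -di; apply: fT => //; apply: Cp.
have [egi gpi _] := gP i (ltn_ord i); have [egj gpj _] := gP j (ltn_ord j).
move=> /(mdvd_act_euclid egi egj) [k [ek kg] /(Sym_of_mdvd F_irr F_deg ek) Sk].
apply: (pij i j (ltn_ord i) (ltn_ord j) _ k Sk); first by [].
by rewrite -gpi -gpj -act_mul // kg.
Qed.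
End Density.

(** * Generic fibres of d_4 *)

Lemma poly_low_dvd (R : nzRingType) (p : {poly R}) k : (forall i, (i < k)%N -> p`_i = 0) ->
  exists2 q, p = q * 'X^k & q`_0 = p`_k.
Proof.
move=> pk; exists (drop_poly k p); last by rewrite coef_drop_poly.
rewrite -{1}(poly_take_drop k p); suff -> : take_poly k p = 0 by rewrite add0r.
by apply/polyP => i; rewrite coef_take_poly coef0; case: ltnP => // /pk.
Qed.

Lemma poly_horner_ext (K : numClosedFieldType) (p q : {poly K}) :
  (forall t, p.[t] = q.[t]) -> p = q.
Proof.
move=> pq; apply/eqP; rewrite -subr_eq0; apply/negPn/negP.
move=> /(infinite_nonroot (@numDomain_infinite K)) [t _].
by rewrite hornerD hornerN pq subrr eqxx.
Qed.

(** * Restriction to lines and orders of vanishing *)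

Section LineRestriction.
Variable K : numClosedFieldType.
Implicit Types (f : {mpoly K[2]}) (p q v : 'rV[K]_2).

(** The lowest terms in the line parameter measure the order of vanishing at [p], and the
    coefficients depend polynomially on [p], which makes conditions on the order closed. *)
Definition on_line p v : {mpoly K[2]} -> {poly K} :=
  mmap polyC (fun i => (p 0 i)%:P + (v 0 i)%:P * 'X).

HB.instance Definition _ p v := GRing.RMorphism.on (on_line p v).

Lemma on_lineE p v f t : (on_line p v f).[t] = f.@[fun i => (p + t *: v) 0 i].
Proof.
rewrite mmap_polyC_horner; apply: meval_eq => i.
by rewrite hornerD hornerM hornerX !hornerC !mxE mulrC.
Qed.

Lemma on_line0 p v f : (on_line p v f)`_0 = f.@[fun i => p 0 i].
Proof. by rewrite -horner_coef0 on_lineE scale0r addr0. Qed.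

Lemma on_lineC p v c : on_line p v c%:MP = c%:P.
Proof. by rewrite /on_line mmapC. Qed.

Lemma on_line_comp n p v (h : {mpoly K[n]}) (lq : n.-tuple {mpoly K[2]}) :
  on_line p v (h \mPo lq) = mmap polyC (fun i => on_line p v (tnth lq i)) h.
Proof.
apply: (@mpoly_rmorph_eq _ _ _ (on_line p v \o comp_mpoly lq)
  (mmap polyC (fun i => on_line p v (tnth lq i)))) => [c|i] /=.
  by rewrite comp_mpolyC on_lineC mmapC.
by rewrite comp_mpolyXU mmapX mmap1U (tnth_nth 0).
Qed.

Lemma on_line_act g p v f : exists w, on_line p v (act_poly g f) = on_line (act g p) w f.
Proof.
(* The image of the direction [v] under the linear part of [g]. *)
exists (act g v - act g 0); apply: poly_horner_ext => t; rewrite !on_lineE act_polyE.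
have lin (x y z : 'rV[K]_2) i : (x + t *: (y - z)) 0 i = x 0 i + t * (y 0 i - z 0 i).
  by rewrite !mxE.
have lin0 (x y : 'rV[K]_2) i : (x + t *: y) 0 i = x 0 i + t * y 0 i by rewrite !mxE.
have zero i : (0 : 'rV[K]_2) 0 i = 0 by rewrite mxE.
apply: meval_eq => i; rewrite lin.
have [a0 a1] := act_mx g (p + t *: v); have [b0 b1] := act_mx g p.
have [c0 c1] := act_mx g v; have [d0 d1] := act_mx g 0.
by case: (ord2P i) => ->; rewrite ?a0 ?a1 ?b0 ?b1 ?c0 ?c1 ?d0 ?d1 !lin0 !zero; ring.
Qed.

Lemma polyfam_on_line (T : Type) N (coord : 'I_N -> T -> K) (p : T -> 'rV[K]_2) v f :
  (forall i, polyfun coord (fun t => p t 0 i)) ->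
  polyfam coord (fun t => on_line (p t) v f).
Proof.
move=> pp; apply: polyfam_mmap => i; apply: polyfamD; first exact: polyfamC.
exact: polyfamcst.
Qed.

Lemma polyfam_on_line_sqdist (T : Type) N (coord : 'I_N -> T -> K) (p q : T -> 'rV[K]_2) v :
  (forall i, polyfun coord (fun t => p t 0 i)) ->
  (forall i, polyfun coord (fun t => q t 0 i)) ->
  polyfam coord (fun t => on_line (q t) v (sqdist_poly (p t))).
Proof.
move=> pp pq; have pX i : polyfam coord (fun t =>
    (on_line (q t) v 'X_i + - 1%:P * (p t 0 i)%:P) ^+ 2).
  apply/polyfamX/polyfamD; first exact: polyfam_on_line.
  by apply: polyfamM; [apply: polyfamcst | apply: polyfamC].
apply: polyfam_eq (polyfamD (pX 0) (pX 1)) => t.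
by rewrite /sqdist_poly rmorphD !rmorphXn !rmorphB /= !on_lineC polyC1 !mulN1r.
Qed.
End LineRestriction.

Section Order.
Variables (K : numClosedFieldType) (F : {mpoly K[2]}).
Hypothesis F_irr : mirreducible F.
Hypothesis F_deg : (2 < msize F)%N.
Let C := zeros [set F].
Implicit Types (H A B D G : {mpoly K[2]}) (p q v : 'rV[K]_2).

Lemma max_power H : H != 0 -> exists j A, H = F ^+ j * A /\ ~ mdvd F A.
Proof.
have [n] := ubnP (msize H); elim: n H => // n IHn H /ltnSE Hn H0.
have [[A HA]|nH] := pselect (mdvd F H); last by exists 0%N, H; rewrite mul1r.
have A0 : A != 0 by apply: contra_neq H0; rewrite HA => ->; rewrite mulr0.
have lt_An : (msize A < n)%N.
  have := F_neq0 F_irr => F0; apply: leq_trans Hn; rewrite HA msizeM //.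
  by case: (msize F) F_deg => [|[|[|k]]] // _; rewrite !addSn /= ltnS leqW // leq_addl.
have [j [D [AD nD]]] := IHn A lt_An A0.
by exists j.+1, D; rewrite exprS -mulrA -AD.
Qed.

Lemma pow_coprime_dvd G j k D : ~ mdvd F G -> mdvd (F ^+ j) (G ^+ k * D) -> mdvd (F ^+ j) D.
Proof.
move=> nG; elim: j D => [|j IHj] D; first by move=> _; exists D; rewrite mul1r.
move=> [E e]; have F0 := F_neq0 F_irr.
have nGk : ~ mdvd F (G ^+ k).
  elim: (k) => [|k' IHk]; last by rewrite exprS => /(mdvd_prime F_irr F_deg) [].
  case=> X XE; case: F_irr => _ /negP nu _; apply: nu.
  by apply/unitrPr; exists X; rewrite -XE expr0.
have [|//|[D' DE]] := mdvd_prime F_irr F_deg (G := G ^+ k) (H := D).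
  by exists (F ^+ j * E); rewrite e exprS mulrA.
have [|W WE] := IHj D'.
  by exists E; apply: (mulfI F0); rewrite mulrCA -DE e exprS mulrA.
by exists W; rewrite DE WE exprS mulrA.
Qed.

(* The generic order of vanishing of F along the lines through points of C. *)
Lemma curve_order : exists e, (0 < e)%N /\
  [/\ exists p v, C p /\ (on_line p v F)`_e != 0 &
      forall p v i, C p -> (i < e)%N -> (on_line p v F)`_i = 0].
Proof.
pose nz e := `[< exists p v, C p /\ (on_line p v F)`_e != 0 >].
have [e0 nze] : exists e, nz e.
  have [w _ Fw] := mpoly_nonroot (@numDomain_infinite K) (F_neq0 F_irr).
  have [p Cp] := infinite_setN0 (curve_infinite F_irr F_deg).
  pose v := (\row_i w i) - p; have : on_line p v F != 0.
    apply: contra_neq Fw => L0; have := on_lineE p v F 1.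
    rewrite L0 horner0 scale1r /v addrC subrK => ->.
    by apply: meval_eq => i; rewrite mxE.
  rewrite -lead_coef_eq0 => L0; exists (size (on_line p v F)).-1.
  by apply/asboolP; exists p, v.
have [e /asboolP ne emin] := ex_minnP (ex_intro _ e0 nze); exists e; split.
  have [p [v [Cp nzp]]] := ne; rewrite lt0n; apply: contraNneq nzp => ->.
  by rewrite on_line0; apply/eqP/curveP.
split=> // p v i Cp ie; apply: contrapT => /eqP nzi.
have := emin i; rewrite leqNgt ie => /(_ _)/negP; apply=> //.
by apply/asboolP; exists p, v.
Qed.

(** Write H = F^j A with [A] not divisible by [F]. At a point of [C] where [A] and the coefficient
    of order [e] of [F] along [v] are both nonzero, [H] has order exactly e j along [v], so m <= e
    j. *)
Lemma order_divides e m H : H != 0 ->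
  (exists p v, C p /\ (on_line p v F)`_e != 0) ->
  (forall p v i, C p -> (i < e)%N -> (on_line p v F)`_i = 0) ->
  (forall p v i, C p -> (i < m)%N -> (on_line p v H)`_i = 0) ->
  exists2 j, (m <= e * j)%N & mdvd (F ^+ j) H.
Proof.
move=> H0 [p [v [Cp nzp]]] Fe Hm; have [j [A [HA nA]]] := max_power H0.
exists j; last by exists A.
have pe : polyfun (@rowcoord K 2) (fun q => (on_line q v F)`_e).
  by apply: polyfam_on_line => i; apply: (polyfun_coord (@rowcoord K 2) i).
have pA : polyfun (@rowcoord K 2) (fun q => A.@[fun i => q 0 i]) by exists A.
have [||q [Cq Fq Aq]] := curve_prime F_irr F_deg pe pA; first by exists p.
  apply: contrapT => h; apply: nA; apply: (curve_ideal F_irr F_deg) => q Cq.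
  by apply: contrapT => /eqP nq; apply: h; exists q.
rewrite leqNgt; apply/negP => lt_em; have := Hm q v _ Cq lt_em.
rewrite HA rmorphM rmorphXn /=.
have [u uE u0] := poly_low_dvd (fun i => Fe q v i Cq).
rewrite uE exprMn -exprM mulrAC coefMXn ltnn subnn coef0M.
rewrite -horner_coef0 horner_exp horner_coef0 u0 on_line0.
by move=> /eqP; apply/negP; rewrite mulf_neq0 // expf_neq0.
Qed.
End Order.

Lemma polyfun_vec3 (K : numClosedFieldType) (T : Type) N (coord : 'I_N -> T -> K) a b c k :
  polyfun coord a -> polyfun coord b -> polyfun coord c ->
  polyfun coord (fun t => vec3 (a t) (b t) (c t) 0 k).
Proof.
move=> pa pb pc; pose jk := enum_val (cast_ord (esym (card_pairs 3)) k).
apply: (@polyfun_eq _ _ _ _ (if jk.1 == 0 then if jk.2 == 1 then a else b else c)) => [t|].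
  by rewrite mxE -/jk; case: ifP => // _; case: ifP.
by case: ifP => // _; case: ifP.
Qed.

Section GenericRigidity.
Variables (K : numClosedFieldType) (F : {mpoly K[2]}).
Hypothesis F_irr : mirreducible F.
Hypothesis F_deg : (2 < msize F)%N.
Let C := zeros [set F].
Implicit Types (P Q : 'M[K]_(4, 2)).

(** The first variables are the three distances among the first three points, ordered as in d_3; the
    last two are d_14 and d_24. *)
Variable Phi : {mpoly K['C(3, 2) + 2]}.

Let top (P : 'M[K]_(4, 2)) := vec3 (sqdist (row 0 P) (row 1 P))
  (sqdist (row 0 P) (row 2%:R P)) (sqdist (row 1 P) (row 2%:R P)).

(* The locus of fourth vertices satisfying [Phi], the first three being rows of P. *)
Definition fourth_vertex P : {mpoly K[2]} :=
  Phi \mPo [tuple match @fintype.split 'C(3, 2) 2 i with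
            | inl e => (top P 0 e)%:MP
            | inr k => sqdist_poly (if k == 0 then row 0 P else row 1 P)
            end | i < 'C(3, 2) + 2].

Lemma fourth_vertexE P (r : 'rV[K]_2) : (fourth_vertex P).@[fun i => r 0 i] =
  Phi.@[fun i => match @fintype.split 'C(3, 2) 2 i with
            | inl e => top P 0 e
            | inr k => sqdist (if k == 0 then row 0 P else row 1 P) r
            end].
Proof.
rewrite comp_mpoly_meval; apply: meval_eq => i; rewrite tnth_mktuple.
by case: (@fintype.split 'C(3, 2) 2 i) => k; rewrite ?mevalC ?sqdist_polyE.
Qed.

Hypothesis Phi_vanish : forall P, cpow C 4 P ->
  (fourth_vertex P).@[fun i => row 3%:R P 0 i] = 0.

Lemma fourth_vertex_act g P : euclid g ->
  fourth_vertex P = act_poly g (fourth_vertex (actrows g P)).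
Proof.
move=> eg; apply: mpoly_rV_ext => r; rewrite act_polyE !fourth_vertexE.
apply: meval_eq => i; case: (@fintype.split 'C(3, 2) 2 i) => k.
  by rewrite /top !row_actrows !sqdist_act.
by case: ifP => _; rewrite !row_actrows sqdist_act.
Qed.

Lemma fourth_vertex_setrow P v : fourth_vertex (setrow P 3%:R v) = fourth_vertex P.
Proof. by rewrite /fourth_vertex /top !row_setrow. Qed.

Lemma polyfam_fourth_vertex v :
  polyfam (@mxcoord K 4) (fun P => on_line (row 3%:R P) v (fourth_vertex P)).
Proof.
apply: (@polyfam_eq _ _ _ _ (fun P => mmap polyC (fun i =>
  match @fintype.split 'C(3, 2) 2 i with
  | inl e => (top P 0 e)%:P
  | inr k => on_line (row 3%:R P) v (sqdist_poly (if k == 0 then row 0 P else row 1 P))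
  end) Phi)) => [P|].
  rewrite on_line_comp; congr (mmap _ _ _); apply: funext => i; rewrite tnth_mktuple.
  by case: (@fintype.split 'C(3, 2) 2 i) => k //; rewrite on_lineC.
have pr (j : 'I_4) (i : 'I_2) := polyfun_row K j i.
apply: polyfam_mmap => i; case: (@fintype.split 'C(3, 2) 2 i) => k.
  by apply/polyfamC/polyfun_vec3; apply: polyfun_sqdist => l; apply: pr.
apply: (@polyfam_on_line_sqdist _ _ _ _ (fun P => if k == 0 then row 0 P else row 1 P)).
  by move=> l; case: (k == 0); apply: pr.
by move=> l; apply: pr.
Qed.

(* At a point of C lying also on g^-1 C, for some g moving C, the polynomial
   [fourth_vertex P] vanishes twice as much as it does generically along C. *)
Lemma generic_rigidity : (exists2 P, cpow C 4 P & fourth_vertex P != 0) ->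
  exists f, [/\ polyfun (@mxcoord K 4) f, exists2 P, cpow C 4 P & f P != 0 &
    forall P, cpow C 4 P -> f P != 0 ->
      forall g, euclid g -> cpow C 4 (actrows g P) -> Sym C g].
Proof.
move=> [P0 CP0 H0].
pose ord P v := on_line (row 3%:R P) v (fourth_vertex P).
pose nz k := `[< exists P v, cpow C 4 P /\ (ord P v)`_k != 0 >].
have [k0 nzk] : exists k, nz k.
  have [q Hq] : exists q : 'rV[K]_2, (fourth_vertex P0).@[fun i => q 0 i] != 0.
    apply: contrapT => h; case/eqP: H0; apply: mpoly_rV_ext => q.
    by rewrite meval0; apply/eqP/negPn/negP => nq; apply: h; exists q.
  pose v := q - row 3%:R P0; have : ord P0 v != 0.
    apply: contra_neq Hq => L0; have := on_lineE (row 3%:R P0) v (fourth_vertex P0) 1.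
    by rewrite -/(ord P0 v) L0 horner0 scale1r /v addrC subrK => ->.
  rewrite -lead_coef_eq0 => L0; exists (size (ord P0 v)).-1.
  by apply/asboolP; exists P0, v.
(* [m] is the least order at the fourth point over all configurations and directions; [f] will be
   the coefficient of that order in one direction where it is not identically zero. *)
have [m /asboolP nm mmin] := ex_minnP (ex_intro _ k0 nzk).
have low P v k : cpow C 4 P -> (k < m)%N -> (ord P v)`_k = 0.
  move=> CP km; apply: contrapT => /eqP nzk'; have := mmin k; rewrite leqNgt km.
  by move=> /(_ _)/negP; apply=> //; apply/asboolP; exists P, v.
have [P1 [v [CP1 nzP1]]] := nm.
have m0 : (0 < m)%N.
  rewrite lt0n; apply: contraNneq nzP1 => ->.
  by rewrite /ord on_line0 Phi_vanish.
have [e [e0 [enz elow]]] := curve_order F_irr F_deg.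
exists (fun P => (ord P v)`_m); split; first exact: polyfam_fourth_vertex; first by exists P1.
move=> P CP fP g eg CgP; apply: contrapT => nS; case/eqP: fP.
have nFg : ~ mdvd F (act_poly g F) by move=> /(Sym_of_mdvd F_irr F_deg eg).
have [HP0|HP0] := eqVneq (fourth_vertex P) 0.
  by rewrite /ord HP0 rmorph0 coef0.
(* The locus depends on the first three points alone, so any point of [C] can replace the fourth:
   the order is at least [m] all along [C]. *)
have powF Q : cpow C 4 Q -> fourth_vertex Q != 0 ->
    exists2 j, (m <= e * j)%N & mdvd (F ^+ j) (fourth_vertex Q).
  move=> CQ HQ; apply: (order_divides F_irr F_deg HQ enz elow) => p w i Cp im.
  have := low (setrow Q 3%:R p) w i (cpow_setrow 3%:R CQ Cp) im.
  by rewrite /ord row_setrow eqxx fourth_vertex_setrow.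
have HE := fourth_vertex_act P eg.
have HP0' : fourth_vertex (actrows g P) != 0.
  by apply: contra_neq HP0; rewrite HE => ->; rewrite rmorph0.
(* Both F^j and (F o g)^j' divide the locus of [P], and [F] does not divide F o g, so their product
   divides it. At the fourth point this product has order at least e j + e j' >= 2 m > m. *)
have [j mj Fj] := powF P CP HP0; have [j' mj' [D DE]] := powF _ CgP HP0'.
have [W WE] : mdvd (F ^+ j) (act_poly g D).
  by apply: (pow_coprime_dvd F_irr F_deg nFg (k := j')); rewrite -rmorphXn -rmorphM -DE /= -HE.
rewrite /ord HE DE (rmorphM (act_poly g)) /= WE (rmorphXn (act_poly g)) !rmorphM !rmorphXn /=.
have [u1 -> _] := poly_low_dvd (fun i => elow (row 3%:R P) v i (CP _)).
have [w ->] := on_line_act g (row 3%:R P) v F.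
have Cg3 : C (act g (row 3%:R P)) by rewrite -row_actrows.
have [u2 -> _] := poly_low_dvd (fun i => elow _ w i Cg3).
set L := on_line _ _ W.
have -> : (u2 * 'X^e) ^+ j' * ((u1 * 'X^e) ^+ j * L) =
    u2 ^+ j' * u1 ^+ j * L * 'X^(e * j' + e * j).
  by rewrite !exprMn -!exprM exprD; ring.
by rewrite coefMXn (leq_trans _ (leq_add mj' mj)) // -addn1 leq_add.
Qed.
End GenericRigidity.

(** * Generic fibres of d_4 as orbits of the symmetry group *)

Section GenericFibers.
Variables (K : numClosedFieldType) (F : {mpoly K[2]}).
Hypothesis F_irr : mirreducible F.
Hypothesis F_deg : (2 < msize F)%N.
Let C := zeros [set F].
Implicit Types (P Q : 'M[K]_(4, 2)).

(** Nonzero exactly when the first three points meet the assumptions of [congruence]. *)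
Definition nondegenerate P :=
  sqdist (row 0 P) (row 1 P) * area (row 0 P) (row 1 P) (row 2%:R P).

Lemma row_addrow_tri (p q r s : 'rV[K]_2) : let P := addrow s (tri p q r) in
  [/\ row 0 P = p, row 1 P = q, row 2%:R P = r & row 3%:R P = s].
Proof.
have [r0 r1 r2] := row_tri p q r.
have l0 : 0 = lift ord_max (0 : 'I_3) :> 'I_4 by apply: val_inj.
have l1 : 1 = lift ord_max (1 : 'I_3) :> 'I_4 by apply: val_inj.
have l2 : 2%:R = lift ord_max (2%:R : 'I_3) :> 'I_4 by apply: val_inj.
have l3 : 3%:R = ord_max :> 'I_4 by apply: val_inj.
split; first by rewrite l0 row_addrow_lift.
- by rewrite l1 row_addrow_lift.
- by rewrite l2 row_addrow_lift.
by rewrite l3 row_addrow_max.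
Qed.

Lemma polyfun_nondegenerate : polyfun (@mxcoord K 4) nondegenerate.
Proof.
apply: polyfunM; first by apply: polyfun_sqdist => i; apply: polyfun_row.
by apply: polyfun_area => i; apply: polyfun_row.
Qed.

Lemma nondegenerate_exists : exists2 P, cpow C 4 P & nondegenerate P != 0.
Proof.
have [p [q [r [Cp Cq Cr pq pqr]]]] := curve_triangle F_irr F_deg.
exists (addrow p (tri p q r)).
  by apply: cpow_addrow => //; apply: cpow_tri.
by rewrite /nondegenerate; have [-> -> -> _] := row_addrow_tri p q r p; rewrite mulf_neq0.
Qed.

Lemma actrows_inj P : nondegenerate P != 0 ->
  {in Sym C &, injective (fun g => actrows g P)}.
Proof.
rewrite mulf_eq0 negb_or => /andP[_ A0] g h /set_mem [eg _] /set_mem [eh _] gh.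
apply: (euclid_eq eg eh A0); by rewrite -!row_actrows gh.
Qed.

Lemma fiber_Sym P : cpow C 4 P -> [set actrows g P | g in Sym C] `<=`
  [set Q | cpow C 4 Q /\ dmap Q = dmap P].
Proof.
move=> CP _ [g Sg <-]; split; first exact: cpow_actrows CP Sg.
by rewrite dmap_actrows //; case: Sg.
Qed.

Lemma fiber_congruent P Q : nondegenerate P != 0 -> dmap Q = dmap P ->
  exists2 g, euclid g & Q = actrows g P.
Proof.
rewrite mulf_eq0 negb_or => /andP[D0 A0] /esym/dmap_eq e.
have [g eg gE] := congruence D0 A0 (e _ _) (e _ _) (e _ _).
exists g => //; apply/row_matrixP => i; rewrite row_actrows.
by apply/esym/gE.
Qed.

Lemma fourth_vertex_relation : zdense (@dmap _ 3 @` cpow C 3 : set 'rV[K]_3) ->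
  exists Phi : {mpoly K['C(3, 2) + 2]},
    (forall P, cpow C 4 P -> (fourth_vertex Phi P).@[fun i => row 3%:R P 0 i] = 0) /\
    exists2 P, cpow C 4 P & fourth_vertex Phi P != 0.
Proof.
move=> dense3.
pose top P := vec3 (sqdist (row 0 P) (row 1 P))
  (sqdist (row 0 P) (row 2%:R P)) (sqdist (row 1 P) (row 2%:R P)).
pose f (i : 'I_5) P : K := match @fintype.split 'C(3, 2) 2 i with
  | inl e => top P 0 e
  | inr k => sqdist (if k == 0 then row 0 P else row 1 P) (row 3%:R P)
  end.
have pr (j : 'I_4) (i : 'I_2) := polyfun_row K j i.
have [|Phi [Phi0 PhiE]] := @curve_power_dependent _ _ (F_neq0 F_irr) 4 f.
  move=> i; rewrite /f; case: (@fintype.split 'C(3, 2) 2 i) => k.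
    by apply: polyfun_vec3; apply: polyfun_sqdist => l; apply: pr.
  apply: (@polyfun_sqdist _ _ _ _ (fun P => if k == 0 then row 0 P else row 1 P)) => l.
    by case: (k == 0); apply: pr.
  exact: pr.
exists Phi; split=> [P CP|]; first by rewrite fourth_vertexE; apply: PhiE.
have [v _ Phiv] := mpoly_nonroot (@numDomain_infinite K) Phi0.
pose v' (i : 'I_('C(3, 2) + 2)) := v i.
(* The last two variables of [Phi] are fixed at coordinates of a point where [Phi] is nonzero.
   Density of the image of d_3 then gives a triangle in [C] with [Psi] and d_12 both nonzero. *)
pose Psi : {mpoly K['C(3, 2)]} := Phi \mPo [tuple match @fintype.split 'C(3, 2) 2 i with
  | inl e => 'X_e | inr k => (v' (rshift 'C(3, 2) k))%:MP end | i < 'C(3, 2) + 2].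
have PsiE (w : 'I_('C(3, 2)) -> K) : Psi.@[w] =
    Phi.@[fun i => match @fintype.split 'C(3, 2) 2 i with
  | inl e => w e | inr k => v' (rshift 'C(3, 2) k) end].
  rewrite comp_mpoly_meval; apply: meval_eq => i; rewrite tnth_mktuple.
  by case: (@fintype.split 'C(3, 2) 2 i) => k; rewrite ?mevalXU ?mevalC.
have Psi0 : Psi != 0.
  apply: contra_neq Phiv => Psi0; have := PsiE (fun e => v' (lshift 2 e)).
  rewrite Psi0 meval0 => ->; apply: meval_eq => i.
  by rewrite -[in LHS](@splitK 'C(3, 2) 2 i) /=; case: (@fintype.split 'C(3, 2) 2 i).
have [e01 e01E] := @dmap_index K 3 0 1 isT.
have [T [CT nT]] : exists T, cpow C 3 T /\ (Psi * 'X_e01).@[fun e => dmap T 0 e] != 0.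
  apply: contrapT => h; have : Psi * 'X_e01 = 0.
    apply: mpoly_rV_ext => w; rewrite meval0.
    apply: (zdense_vanish dense3 (f := fun w => (Psi * 'X_e01).@[fun e => w 0 e])).
      by exists (Psi * 'X_e01).
    by move=> _ [T CT <-]; apply/eqP/negPn/negP => nT; apply: h; exists T.
  move/eqP; rewrite mulf_eq0 (negPf Psi0) /= -msize_poly_eq0 msizeX //.
move: nT; rewrite mevalM mevalXU mulf_eq0 negb_or e01E => /andP[nT D0].
(* [s] is a point of the plane realizing the two fixed values, where the locus polynomial is
   nonzero. The fourth row of the witness only has to lie on [C], so a vertex is repeated. *)
have [s [s0 s1]] := two_circles (v' (rshift 'C(3, 2) 0)) (v' (rshift 'C(3, 2) 1)) D0.
have P0E := row_addrow_tri (row 0 T) (row 1 T) (row 2%:R T) (row 0 T).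
exists (addrow (row 0 T) (tri (row 0 T) (row 1 T) (row 2%:R T))).
  by apply: cpow_addrow; [apply: cpow_tri; apply: CT | apply: CT].
apply: contra_neq nT => H0; have := fourth_vertexE Phi
  (addrow (row 0 T) (tri (row 0 T) (row 1 T) (row 2%:R T))) s.
have [-> -> -> _] := P0E; rewrite H0 meval0 PsiE => ->.
apply: meval_eq => i; case: (@fintype.split 'C(3, 2) 2 i) => k.
  by rewrite [in LHS](tri_row T) dmap_tri.
by case: (ord2P k) => -> /=.
Qed.

(** The exceptional set is the zero set of [f] times [nondegenerate]. Off it, points of the fibre
    are congruent to [P], and rigidity turns the motion into a symmetry. *)
Lemma dense_generically n : zdense (@dmap _ 3 @` cpow C 3 : set 'rV[K]_3) ->
  (Sym C #= `I_n)%card -> dmap_generically 4 C n.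
Proof.
move=> /fourth_vertex_relation [Phi [Phi_vanish Phi_nz]] Sn.
have [f [pf fnz fSym]] := generic_rigidity F_irr F_deg Phi_vanish Phi_nz.
have [h hE] := polyfunM pf polyfun_nondegenerate.
have [P0 [CP0 fP0 ndP0]] := curve_power_prime F_irr F_deg pf polyfun_nondegenerate
  fnz nondegenerate_exists.
exists (zeros [set h]); split; first by exists [set h].
  exists P0; split=> //= /(_ h erefl) /eqP; apply/negP.
  by have := hE P0; rewrite /mxcoord => <-; rewrite mulf_neq0.
move=> P [CP nZ]; have : f P * nondegenerate P != 0.
  by apply/eqP => e; apply: nZ => _ ->; rewrite -[RHS]e hE.
rewrite mulf_eq0 negb_or => /andP[fP ndP].
have -> : [set Q | cpow C 4 Q /\ dmap Q = dmap P] = [set actrows g P | g in Sym C].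
  apply/seteqP; split; last exact: fiber_Sym.
  move=> Q [CQ QP]; have [g eg QE] := fiber_congruent ndP QP.
  by exists g => //; apply: (fSym P CP fP g eg); rewrite -QE.
by rewrite (card_eql (inj_card_eq (actrows_inj ndP))).
Qed.

Lemma generic_point (Z : set 'rV[K]_(4 * 2)) f : zclosed Z ->
  cpow C 4 `&` [set P | ~ Z (mxvec P)] !=set0 -> polyfun (@mxcoord K 4) f ->
  (exists2 P, cpow C 4 P & f P != 0) ->
  exists P, [/\ cpow C 4 P, ~ Z (mxvec P) & f P != 0].
Proof.
move=> [S ->] [P0 [CP0 nZ]] pf fnz.
have [s [Ss sP0]] : exists s, S s /\ s.@[fun i => mxvec P0 0 i] != 0.
  apply: contrapT => h; apply: nZ => s Ss.
  by apply/eqP/negPn/negP => ns; apply: h; exists s.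
have ps : polyfun (@mxcoord K 4) (fun P => s.@[fun i => mxvec P 0 i]) by exists s.
have [|P [CP sP fP]] := curve_power_prime F_irr F_deg ps pf _ fnz; first by exists P0.
exists P; split=> // ZP; case/eqP: sP; exact: ZP.
Qed.

Lemma generically_finite_Sym n : dmap_generically 4 C n -> finite_set (Sym C).
Proof.
move=> [Z [Zcl Zne fib]].
have [P [CP nZ ndP]] := generic_point Zcl Zne polyfun_nondegenerate nondegenerate_exists.
rewrite -(eq_finite_set (inj_card_eq (actrows_inj ndP))).
apply: sub_finite_set (fiber_Sym CP) _.
by exists n; apply: fib.
Qed.

(** Two nonempty open subsets of C^4 meet, and the fibre over a common point has both
    cardinalities. *)
Lemma generically_inj m n : dmap_generically 4 C m -> dmap_generically 4 C n -> m = n.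
Proof.
move=> [Z [Zcl Zne fib]] [_ [[S ->] [P0 [CP0 nP0]] fib']].
have [s [Ss sP0]] : exists s, S s /\ s.@[fun i => mxvec P0 0 i] != 0.
  apply: contrapT => h; apply: nP0 => s Ss.
  by apply/eqP/negPn/negP => ns; apply: h; exists s.
have ps : polyfun (@mxcoord K 4) (fun P => s.@[fun i => mxvec P 0 i]) by exists s.
have [|P [CP nZ sP]] := generic_point Zcl Zne ps; first by exists P0.
have nZ' : ~ zeros S (mxvec P) by move=> /(_ s Ss) /eqP; apply/negP.
apply/card_eq_II.
apply: card_eq_trans (fib' P (conj CP nZ')).
by rewrite card_eq_sym; apply: fib.
Qed.

End GenericFibers.

(** * Dimension of the joint signature *)

(* The x_i vanish on Z_(i-1) but not on Z_i; a relation between them on Z_e,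
   divided by a power of the last one, restricts to a shorter relation on Z_(e-1). *)
Lemma chain_independent (K : fieldType) (m : nat) (Z : nat -> set 'rV[K]_m) e :
  (forall i, (i <= e)%N -> zclosed (Z i) /\ zirreducible (Z i)) ->
  (forall i, (i < e)%N -> Z i `<` Z i.+1) ->
  exists x : 'I_e -> {mpoly K[m]}, forall Q : {mpoly K[e]},
    (forall v, Z e v -> Q.@[fun i => (x i).@[fun l => v 0 l]] = 0) -> Q = 0.
Proof.
elim: e => [|e IHe] Zi Zs.
  exists (fun=> 0) => Q Q0; have [_ [[v Zv] _]] := Zi 0%N isT.
  move: (Q0 v Zv); rewrite [Q]mpoly0_const mevalC => ->; exact: mpolyC0.
have [||x xind] := IHe.
- by move=> i ie; apply: Zi; rewrite ltnW.
- by move=> i ie; apply: Zs; rewrite ltnW.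
have [[S ZE] _] := Zi e (leqnSn e).
have [sub /nonsubset [v [Zv nZv]]] := Zs e (leqnn _).
have [s [Ss sv]] : exists s, S s /\ s.@[fun l => v 0 l] != 0.
  apply: contrapT => h; apply: nZv; rewrite ZE => s Ss.
  by apply/eqP/negPn/negP => ns; apply: h; exists s.
exists (fun i => if unlift ord_max i is Some j then x j else s) => Q Q0.
apply: contrapT => /eqP Qn0.
have p0 : split_last Q != 0.
  by apply: contra_neq Qn0 => p0; apply: split_last_inj; rewrite p0 rmorph0.
(* The lowest power of the new variable is factored out, leaving [q] with q(0) nonzero. *)
have [k [q]] := multiplicity_XsubC (split_last Q) 0; rewrite p0 subr0 /= => q0 pE.
pose qx : {mpoly K[m]} := (map_poly (comp_mpoly [tuple x j | j < e]) q).[s].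
have qxE w : qx.@[fun l => w 0 l] =
    (map_poly (meval (fun j => (x j).@[fun l => w 0 l])) q).[s.@[fun l => w 0 l]].
  rewrite /qx -horner_map -map_poly_comp; congr (_.[_]).
  apply: eq_map_poly => h /=; rewrite comp_mpoly_meval; apply: meval_eq => j.
  by rewrite tnth_mktuple.
have cover : Z e.+1 `<=` zeros [set qx] `|` zeros [set s].
  move=> w Zw; have := Q0 w Zw.
  rewrite -split_last_horner unlift_none pE.
  rewrite (@eq_map_poly _ _ _ (meval (fun j => (x j).@[fun l => w 0 l]))); last first.
    by move=> h; apply: meval_eq => j; rewrite liftK.
  rewrite rmorphM rmorphXn /= map_polyX hornerM hornerXn -qxE => /eqP.
  rewrite mulf_eq0 => /orP[/eqP e0|]; first by left=> _ ->.
  by rewrite expf_eq0 => /andP[_ /eqP e0]; right=> _ ->.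
have [_ [_ Zirr]] := Zi e.+1 (leqnn _).
(* By irreducibility [Z e.+1] lies in qx = 0 or in s = 0, and [v] excludes the latter. On [Z e],
   where [s] vanishes, qx = 0 is the relation given by q(0), which the induction hypothesis forces
   to be zero. *)
have [//|||sub2] := Zirr _ _ _ _ cover; try by eexists.
  move=> sub1; suff q00 : q`_0 = 0 by move: q0; rewrite /root horner_coef0 q00 eqxx.
  apply: xind => w Zw; have := sub1 w (sub w Zw) qx erefl; rewrite qxE.
  have -> : s.@[fun l => w 0 l] = 0 by rewrite ZE in Zw; apply: Zw.
  by rewrite horner_coef0 coef_map.
by case/eqP: sv; apply: (sub2 v Zv).
Qed.

(** Two polynomials, each nonzero somewhere on the image, are both nonzero at a common
    configuration, by [curve_power_prime]. *)
Lemma polyfun_curve_powers_irreducible (K : numClosedFieldType) (F : {mpoly K[2]}) k m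
    (G : 'M[K]_(k, 2) -> 'rV[K]_m) : mirreducible F -> (2 < msize F)%N ->
  (forall i, polyfun (@mxcoord K k) (fun P => G P 0 i)) ->
  zirreducible (zclosure (G @` cpow (zeros [set F]) k)).
Proof.
move=> F_irr F_deg pG; set A := G @` _; split.
  have [a Ca] := infinite_setN0 (curve_infinite F_irr F_deg).
  exists (G (\matrix_(i, j) a 0 j)); apply: sub_gen_smallest; exists (\matrix_(i, j) a 0 j) => //.
  move=> i; have -> // : row i (\matrix_(i0 < k, j < 2) a 0 j) = a.
  by apply/rowP => j; rewrite !mxE.
move=> _ _ [S ->] [S' ->] cover.
have witness (T : set {mpoly K[m]}) : ~ zclosure A `<=` zeros T ->
    exists s, T s /\ exists2 P, cpow (zeros [set F]) k P & s.@[fun i => G P 0 i] != 0.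
  move=> nsub; apply: contrapT => h; apply: nsub; apply: smallest_sub; first by exists T.
  move=> _ [P CP <-] s Ts; apply/eqP/negPn/negP => ns; apply: h.
  by exists s; split=> //; exists P.
apply: contrapT => /not_orP [/witness [s [Ss sP]] /witness [s' [Ss' sP']]].
have ps t : polyfun (@mxcoord K k) (fun P => t.@[fun i => G P 0 i]) by apply: polyfun_meval.
have [P [CP nP nP']] := curve_power_prime F_irr F_deg (ps s) (ps s') sP sP'.
have [|/(_ s Ss)/eqP|/(_ s' Ss')/eqP] := cover (G P); last 2 first.
- exact/negP.
- exact/negP.
by apply: sub_gen_smallest; exists P.
Qed.

Section Dimension.
Variables (K : numClosedFieldType) (F : {mpoly K[2]}).
Hypothesis F_irr : mirreducible F.
Hypothesis F_deg : (2 < msize F)%N.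
Let C := zeros [set F].

(** A relation on [X] persists on its closure, hence on the top member of the chain, against
    [chain_independent]. *)
Lemma dependent_no_chain (m e : nat) (X : set 'rV[K]_m) Z :
  (forall x : 'I_e -> {mpoly K[m]}, exists Q : {mpoly K[e]}, Q != 0 /\
     forall v, X v -> Q.@[fun i => (x i).@[fun l => v 0 l]] = 0) ->
  ~ zchain (zclosure X) e Z.
Proof.
move=> dep [Zi Zs]; have [|x xind] := @chain_independent _ _ Z e _ Zs.
  by move=> i /Zi [].
have [Q [Q0 QX]] := dep x; case/eqP: Q0; apply: xind => v Zv.
have [_ _ Zsub] := Zi e (leqnn e).
have := @zclosure_vanish _ _ X (Q \mPo [tuple x i | i < e]) _ v (Zsub v Zv).
rewrite comp_mpoly_meval => <-; first by apply: meval_eq => i; rewrite tnth_mktuple.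
by move=> w Xw; rewrite comp_mpoly_meval -[RHS](QX w Xw); apply: meval_eq => i;
  rewrite tnth_mktuple.
Qed.

Lemma zchain_trunc m (X : set 'rV[K]_m) e e' Z : (e' <= e)%N -> zchain X e Z -> zchain X e' Z.
Proof.
move=> ee [Zi Zs]; split=> i ie; first by apply: Zi; rewrite (leq_trans ie).
by apply: Zs; rewrite (leq_trans ie).
Qed.

Lemma joint_signature_dim_le4 e Z : zchain (zclosure (joint_signature C)) e Z -> (e <= 4)%N.
Proof.
move=> ch; rewrite leqNgt; apply/negP => e5.
apply: (@dependent_no_chain 6 5 (joint_signature C) Z _ (zchain_trunc e5 ch)) => x.
have [|Q [Q0 QE]] := @curve_power_dependent _ _ (F_neq0 F_irr) 4
    (fun i P => (x i).@[fun l => dmap P 0 l]).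
  by move=> i; apply: polyfun_meval => l; apply: polyfun_dmap.
by exists Q; split=> // _ [P CP <-]; apply: QE.
Qed.

Lemma dim4_finite_Sym : zdim_is (joint_signature C) 4 -> finite_set (Sym C).
Proof.
move=> [[Z ch] _]; apply: contrapT => Sinf.
apply: (@dependent_no_chain 6 4 (joint_signature C) Z _ ch) => x.
have [|Q [Q0 QE]] := @infinite_Sym_dependent _ _ F_irr F_deg 3
    (fun i v => (x i).@[fun l => v 0 l]) Sinf.
  by move=> i; exists (x i).
by exists Q; split=> // _ [P CP <-]; apply: QE.
Qed.

(* The configurations of four points with the last [4 - k] ones at [a]. *)
Definition pad (a : 'rV[K]_2) k (P : 'M[K]_(k, 2)) : 'M[K]_(4, 2) :=
  \matrix_(i, j) if insub (i : nat) is Some i' then P (i' : 'I_k) j else a 0 j.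

Lemma row_pad_lt a k (P : 'M[K]_(k, 2)) (i : 'I_4) (i' : 'I_k) : i = i' :> nat ->
  row i (pad a P) = row i' P.
Proof. by move=> ii; apply/rowP => j; rewrite !mxE ii valK. Qed.

Lemma row_pad_ge a k (P : 'M[K]_(k, 2)) (i : 'I_4) : (k <= i)%N -> row i (pad a P) = a.
Proof. by move=> ki; apply/rowP => j; rewrite !mxE insubN // -leqNgt. Qed.

Lemma cpow_pad a k (P : 'M[K]_(k, 2)) : C a -> cpow C k P -> cpow C 4 (pad a P).
Proof.
move=> Ca CP i; have [ik|ki] := ltnP i k; last by rewrite row_pad_ge.
by rewrite (@row_pad_lt _ _ _ i (Ordinal ik)).
Qed.

Lemma pad_addrow a k (P : 'M[K]_(k, 2)) : pad a (addrow a P) = pad a P.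
Proof.
apply/row_matrixP => i; have [ik|ki] := ltnP i k.
  rewrite (@row_pad_lt _ _ _ i (Ordinal ik)) //.
  rewrite (@row_pad_lt _ _ _ i (lift ord_max (Ordinal ik))) ?row_addrow_lift //.
  by rewrite lift_max.
rewrite (row_pad_ge a P ki); have [ik|ik] := ltnP k i; first by rewrite row_pad_ge.
rewrite (@row_pad_lt _ _ _ i ord_max) ?row_addrow_max //.
by apply/eqP; rewrite eqn_leq ik.
Qed.

Lemma polyfun_pad a k i j : polyfun (@mxcoord K k) (fun P => pad a P i j).
Proof.
have [ik|ki] := ltnP i k.
  apply: polyfun_eq (polyfun_mxentry K (Ordinal ik) j) => P.
  have <- : row i (pad a P) 0 j = pad a P i j by rewrite mxE.
  by rewrite (@row_pad_lt a k P i (Ordinal ik)) // mxE.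
by apply: polyfun_eq (polyfun_cst _ (a 0 j)) => P; rewrite mxE insubN // -leqNgt.
Qed.

Lemma polyfun_dmap_pad a k e : polyfun (@mxcoord K k) (fun P => dmap (pad a P) 0 e).
Proof.
apply: (@polyfun_mxcomp K _ _ (@mxcoord K k) 4 (@pad a k) (fun P => dmap P 0 e)).
  by move=> i j; apply: polyfun_pad.
exact: polyfun_dmap.
Qed.

(** Says that the functions on C^k obtained from [D] have transcendence degree at least [k]. *)
Definition independent_on k (D : 'M[K]_(k, 2) -> 'rV[K]_6) :=
  exists x : 'I_k -> {mpoly K[6]}, forall Q : {mpoly K[k]}, Q != 0 ->
    exists2 P, cpow C k P & Q.@[fun i => (x i).@[fun l => D P 0 l]] != 0.

(** The squared distances from [a] to the [k] free points vary independently, each over an infinite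
    set; k < 4 ensures that some point stays at [a]. *)
Lemma pad_independent a k : C a -> (k < 4)%N ->
  independent_on (fun P : 'M_(k, 2) => dmap (pad a P)).
Proof.
move=> Ca k4.
have /choice [e eE] : forall i : 'I_k, exists e : 'I_6, forall P : 'M[K]_(k, 2),
    dmap (pad a P) 0 e = sqdist a (row i P).
  move=> i; have i4 : (i < 4)%N by rewrite (ltn_trans _ k4).
  have i3 : (Ordinal i4 < (ord_max : 'I_4))%N by apply: leq_trans (ltn_ord i) _; rewrite -ltnS.
  have [e eE] := @dmap_index K 4 _ _ i3; exists e => P.
  have k3 : (k <= (ord_max : 'I_4))%N by rewrite -ltnS.
  by rewrite eE (row_pad_lt a P (erefl : Ordinal i4 = i :> nat)) (row_pad_ge a P k3) sqdistC.
exists (fun i => 'X_(e i)) => Q Q0.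
have [v Sv Qv] := mpoly_nonroot (infinite_sqdist F_irr F_deg Ca) Q0.
have /choice [p pE] : forall i, exists q, C q /\ sqdist a q = v i.
  by move=> i; have [q Cq qv] := Sv i; exists q.
have rP i : row i (\matrix_(i, j) p i 0 j) = p i by apply/rowP => j; rewrite !mxE.
exists (\matrix_(i, j) p i 0 j); first by move=> i; rewrite rP; case: (pE i).
rewrite (meval_eq (v2 := v)) // => i.
by rewrite mevalXU eE rP; case: (pE i).
Qed.

(** Three of the functions are the distances among the first three points, whose values are dense.
    The fourth is d_14, which takes infinitely many values once these points are fixed so that the
    leading coefficient of [Q] in d_14 is nonzero. *)
Lemma dense_independent a : zdense (@dmap _ 3 @` cpow C 3 : set 'rV[K]_3) ->
  independent_on (fun P : 'M_(4, 2) => dmap (pad a P)).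
Proof.
move=> dense3.
have padE (P : 'M[K]_(4, 2)) : pad a P = P.
  by apply/row_matrixP => i; rewrite (@row_pad_lt _ _ _ i i).
have ex (e : 'I_('C(3, 2))) : exists e' : 'I_('C(4, 2)), forall (T : 'M[K]_(3, 2)) p,
    dmap (addrow p T) 0 e' = dmap T 0 e.
  have [j [k [jk je]]] := dmap_entry K e.
  have jk4 : (lift (ord_max : 'I_4) j < lift (ord_max : 'I_4) k)%N by rewrite !lift_max.
  have [e' e'E] := @dmap_index K 4 _ _ jk4; exists e' => T p.
  by rewrite e'E je !row_addrow_lift.
have [e eE] := choice ex.
have [e03 e03E] := @dmap_index K 4 (lift ord_max 0) ord_max isT.
pose x (i : 'I_4) : {mpoly K[6]} := if unlift ord_max i is Some l then 'X_(e l) else 'X_e03.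
exists x => Q Q0.
have q0 : lead_coef (split_last Q) != 0.
  rewrite lead_coef_eq0; apply: contra_neq Q0 => e0.
  by apply: split_last_inj; rewrite e0 rmorph0.
have [T [CT qT]] : exists T, cpow C 3 T /\ (lead_coef (split_last Q)).@[fun l => dmap T 0 l] != 0.
  apply: contrapT => h; case/eqP: q0; apply: mpoly_rV_ext => w; rewrite meval0.
  apply: (zdense_vanish dense3 (f := fun w => (lead_coef (split_last Q)).@[fun l => w 0 l])).
    by exists (lead_coef (split_last Q)).
  by move=> _ [T CT <-]; apply/eqP/negPn/negP => nT; apply: h; exists T.
have r0 : map_poly (meval (fun l => dmap T 0 l)) (split_last Q) != 0.
  by rewrite -lead_coef_eq0 lead_coef_map_eq.
have [_ [p Cp <-] np] := infinite_nonroot (infinite_sqdist F_irr F_deg (CT 0)) r0.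
exists (addrow p T); first exact: cpow_addrow.
apply: contra_neq np => <-; rewrite padE -split_last_horner /x unlift_none mevalXU.
rewrite e03E row_addrow_lift row_addrow_max; congr (_.[_]); apply: eq_map_poly => h.
by apply: meval_eq => l; rewrite liftK mevalXU eE.
Qed.

Lemma dense_dim4 : zdense (@dmap _ 3 @` cpow C 3 : set 'rV[K]_3) ->
  zdim_is (joint_signature C) 4.
Proof.
move=> dense3; split; last exact: joint_signature_dim_le4.
have [a Ca] := infinite_setN0 (curve_infinite F_irr F_deg).
pose D k (P : 'M[K]_(k, 2)) : 'rV[K]_6 := dmap (pad a P).
exists (fun k => zclosure (D k @` cpow C k)); split=> k k4.
  split; first exact: zclosed_zclosure.
    apply: polyfun_curve_powers_irreducible => // i; exact: polyfun_dmap_pad.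
  apply: smallest_sub; first exact: zclosed_zclosure.
  by move=> _ [P CP <-]; apply: sub_gen_smallest; exists (pad a P) => //; apply: cpow_pad.
split.
  apply: smallest_sub; first exact: zclosed_zclosure.
  move=> _ [P CP <-]; apply: sub_gen_smallest; exists (addrow a P).
    exact: cpow_addrow.
  by rewrite /D pad_addrow.
(* Strictness: k + 1 functions independent on C^(k + 1) satisfy a relation on C^k, and the inclusion
   of closures would carry this relation over to C^(k + 1). *)
move=> sub; have [x xind] : independent_on (D k.+1).
  move: k4; rewrite leq_eqVlt => /orP[/eqP[->]|]; first exact: dense_independent.
  exact: pad_independent.
have [|Q [Q0 QE]] := @curve_power_dependent _ _ (F_neq0 F_irr) k
    (fun i P => (x i).@[fun l => D k P 0 l]).
  by move=> i; apply: polyfun_meval => l; apply: polyfun_dmap_pad.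
have [P CP] := xind Q Q0; move/eqP; apply.
have := @zclosure_vanish _ _ (D k @` cpow C k) (Q \mPo [tuple x i | i < k.+1]) _ (D k.+1 P).
rewrite comp_mpoly_meval => <-.
- by apply: meval_eq => i; rewrite tnth_mktuple.
- move=> _ [P' CP' <-]; rewrite comp_mpoly_meval -[RHS](QE P' CP'); apply: meval_eq => i.
  by rewrite tnth_mktuple.
by apply: sub; apply: sub_gen_smallest; exists P.
Qed.

End Dimension.

(** * The equivalences *)

Section Equivalences.
Variables (K : numClosedFieldType) (F : {mpoly K[2]}).
Hypothesis F_irr : mirreducible F.
Hypothesis F_deg : (2 < msize F)%N.
Let C := zeros [set F].

Lemma finite_Sym_card : finite_set (Sym C) -> exists2 n : nat, (0 < n)%N & (Sym C #= `I_n)%card.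
Proof.
move=> [n Sn]; exists n => //; rewrite lt0n; apply/eqP => n0.
move: Sn; rewrite n0 II0 card_eq0 => /eqP S0.
by have := Sym1 F_irr F_deg; rewrite -/C S0.
Qed.

(** Conversely, generic finiteness of the fibres makes [Sym C] finite, of some cardinality [m]; the
    fibres then generically have [m] points, so n = m. *)
Lemma card_Sym_generically n :
  (Sym C #= `I_n)%card <-> dmap_generically 4 C n.
Proof.
split=> [Sn|gen].
  by apply: dense_generically => //; apply: finite_Sym_dense => //; exists n.
have Sfin := generically_finite_Sym F_irr F_deg gen.
have [m Sm] := Sfin; suff -> : n = m by [].
apply: (generically_inj F_irr F_deg gen).
by apply: dense_generically => //; apply: finite_Sym_dense.
Qed.

End Equivalences.

Theorem proposition2p35 (R : realType) (C : set 'rV[R[i]]_2) (d : nat)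
    (hC : irreducible_plane_curve C d) (hd : (1 < d)%N) :
  [/\ zdense (@dmap _ 3 @` cpow C 3 : set 'rV[R[i]]_3) <->
        exists2 n : nat, (0 < n)%N & (Sym C #= `I_n)%card,
      forall n : nat, (0 < n)%N ->
        ((Sym C #= `I_n)%card <-> dmap_generically 4 C n) &
      zdim_is (joint_signature C) 4 <->
        exists2 n : nat, (0 < n)%N & dmap_generically 4 C n].
Proof.
case: hC => F [F_irr Fd ->]; have F_deg : (2 < msize F)%N by rewrite Fd ltnS.
split=> [|n _|].
- split=> [dense3|[n _ Sn]].
    apply: finite_Sym_card => //; apply: contrapT => Sinf.
    exact: infinite_Sym_not_dense dense3.
  by apply: finite_Sym_dense => //; exists n.
- exact: card_Sym_generically.
split=> [dim4|[n _ gen]].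
  have [n n0 Sn] := finite_Sym_card F_irr F_deg (dim4_finite_Sym F_irr F_deg dim4).
  by exists n => //; apply/card_Sym_generically.
apply: dense_dim4 => //; apply: finite_Sym_dense => //.
exact: generically_finite_Sym gen.
Qed.
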